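(* Let $H:T^*Q\to\mathbb{R}$ be a Hamiltonian and define $$S_2(q_0,p,t)=\operatorname*{ext}_{\substack{(q,p)\in C^2([0,t],T^*Q)\\ q(0)=q_0,\ p(t)=p}}\left(p(t)\,q(t)-\int_0^t\left[p(s)\dot q(s)-H(q(s),p(s))\right]ds\right).$$ Then $S_2(q_0,p,t)$ satisfies the Type II Hamilton--Jacobi equation $$\frac{\partial S_2(q_0,p,t)}{\partial t}=H\left(\frac{\partial S_2}{\partial p}(q_0,p,t),\,p\right).$$
   Context: $Q$ is an $n$-dimensional configuration manifold; one works in canonical coordinates $(q,p)$ on $T^*Q$, so $Q$ may be regarded as an open subset of $\mathbb{R}^n$ and $pq=\sum_i p_iq^i$. In the definition of $S_2$, the final value $p(t)$ of the momentum curve is fixed to be the argument $p$ of $S_2$. The notation $\operatorname{ext}$ denotes the extremal (stationary) value: the value of the functional at a curve that makes it stationary with respect to all variations satisfying $\delta q(0)=0$, $\delta p(t)=0$. It is understood that, for the arguments $(q_0,p,t)$ considered, this stationary curve exists, is unique and depends differentiably on $(q_0,p,t)$, so that $S_2$ is a well-defined differentiable function; $H$ is assumed sufficiently smooth. *)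

(* Defs.v *)
(* MathComp-Analysis, over an arbitrary [R : realType]. *)
From HB Require Import structures.
From mathcomp Require Export all_boot all_order all_algebra.
From mathcomp Require Export all_classical all_reals all_analysis.
Export numFieldNormedType.Exports.

Set Implicit Arguments.
Unset Strict Implicit.
Unset Printing Implicit Defensive.

Import Order.TTheory GRing.Theory Num.Theory.

Local Open Scope classical_set_scope.
Local Open Scope ring_scope.

(* For [U] open in a finite-dimensional space this is the usual class C^k(U):
   all iterated directional derivatives up to order k exist and are
   continuous. *)
Fixpoint Ck (R : realType) (V W : normedModType R) (k : nat) (U : set V)
    (f : V -> W) : Prop :=
  if k is j.+1 then
    (forall x, U x -> differentiable f x) /\
    (forall v : V, Ck j U (fun x => 'D_v f x))
  else forall x, U x -> {for x, continuous f}.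

(* C^2([0,t]): restrictions to [0,t] of C^2 curves on the line.  The values of
   [c] outside [0,t] are irrelevant. *)
Definition C2_itv (R : realType) (V : normedModType R) (t : R) (c : R -> V) :
    Prop :=
  exists2 d : R -> V, Ck 2 setT d & {in `[0, t], c =1 d}.

Definition pairing (R : realType) (n : nat) (p q : 'rV[R]_n) : R :=
  \sum_(i < n) p 0 i * q 0 i.

(* The derivative of [q] at the endpoints 0 and t is two-sided, hence
   meaningless for a curve on [0,t], but this does not affect the integral. *)
Definition action (R : realType) (n : nat) (H : 'rV[R]_n * 'rV[R]_n -> R)
    (t : R) (q p : R -> 'rV[R]_n) : R :=
  pairing (p t) (q t) -
  \int[lebesgue_measure]_(s in `[0, t])
    (pairing (p s) (derive1 q s) - H (q s, p s)).

Definition admissible (R : realType) (n : nat) (Q : set 'rV[R]_n)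
    (q0 pt : 'rV[R]_n) (t : R) (q p : R -> 'rV[R]_n) : Prop :=
  [/\ C2_itv t q, C2_itv t p, forall s, s \in `[0, t] -> Q (q s),
      q 0 = q0 & p t = pt].

(* As [Q] is open and [0,t] is compact, the varied curve stays in T^*Q for all
   small [e], so the values of [H] outside T^*Q = Q x R^n play no role. *)
Definition stationary (R : realType) (n : nat) (Q : set 'rV[R]_n)
    (H : 'rV[R]_n * 'rV[R]_n -> R) (q0 pt : 'rV[R]_n) (t : R)
    (q p : R -> 'rV[R]_n) : Prop :=
  admissible Q q0 pt t q p /\
  forall dq dp : R -> 'rV[R]_n,
    C2_itv t dq -> C2_itv t dp -> dq 0 = 0 -> dp t = 0 ->
    is_derive (0 : R) (1 : R)
      (fun e : R => action H t (fun s => q s + e *: dq s)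
                               (fun s => p s + e *: dp s))
      (0 : R).

(* The extremal value; arbitrary if there is no stationary curve, or if
   stationary curves with different values exist. *)
Definition S2 (R : realType) (n : nat) (Q : set 'rV[R]_n)
    (H : 'rV[R]_n * 'rV[R]_n -> R) (q0 pt : 'rV[R]_n) (t : R) : R :=
  get [set v : R | exists q p : R -> 'rV[R]_n,
         stationary Q H q0 pt t q p /\ v = action H t q p].

Definition gradient (R : realType) (n : nat) (f : 'rV[R]_n -> R)
    (x : 'rV[R]_n) : 'rV[R]_n :=
  \row_(i < n) 'D_(delta_mx 0 i) f x.

(* Main.v *)
(* A stationary curve solves Hamilton's equations q' = H_p, p' = -H_q: in the
   first variation one tests against double primitives of q' - H_p and
   p' + H_q.  Rescale time to [0, 1] and compare the curve of
   x = (q0, p, t) with that of y = (q0, p', t').  Gronwall's inequality makes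
   the two curves uniformly O(|y - x|)-close as soon as their initial momenta
   are, and the latter holds because the initial momentum depends
   differentiably on the parameters.  Expanding the action to second order,
   Hamilton's equations and the conservation of energy leave
     S2 y - S2 x = (p' - p) q(t) + (t' - t) H(q(t), p) + O(|y - x|^2),
   so that dS2/dp = q(t) and dS2/dt = H(q(t), p). *)
Require Import Defs.
From mathcomp Require Import measurable_realfun ring lra.

Set Implicit Arguments.
Unset Strict Implicit.
Unset Printing Implicit Defensive.

Import Order.TTheory GRing.Theory Num.Theory.

Local Open Scope classical_set_scope.
Local Open Scope ring_scope.

(** * One-variable calculus *)

(** Differentiable dependence of the curves on the parameters is pointwise in the rescaled time and
    gives no uniform estimate, so the action cannot simply be differentiated under the integral
    sign. Derivatives of the action and of [S2] are instead read off from quadratic remainders. For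
    [S2] the remainder is an endpoint product of two small quantities plus the increment over [0, 1]
    of an explicit function whose derivative is of second order at each time: p dq' + p' dq is the
    derivative of p dq, dq vanishes at time 0, and at the final time the boundary term p(t) q(t) of
    the functional leaves exactly the increment of p paired with q(t). Conservation of energy makes
    the effect of the changed duration a constant multiple of rescaled time. A second obstacle is
    that [Q] is merely open and second derivatives of [H] are merely continuous: Lipschitz and
    Taylor bounds hold only in a tube around the reference curve, and the differential inequality
    behind Gronwall is known only while the other curve stays in that tube. [barrier] breaks this
    circle. *)

Section RealAnalysis.
Variable R : realType.

(* Unlike [is_derive], not a typeclass: as a hypothesis of a lemma it does not
   trigger instance search. *)
Definition has_derivative (V : normedModType R) (f : R -> V) (x : R) (l : V) :
  Prop := is_derive x (1 : R) f l.

(** The common source of the first variation of the action and of both derivatives of [S2]: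
    existence and value of the derivative come together from one estimate. *)
Lemma is_derive_quadratic (V : normedModType R) (f : V -> R) (a v : V)
    (l C r : R) :
  0 < r ->
  (forall h : R, `|h| < r -> `|f (a + h *: v) - f a - h * l| <= C * h ^+ 2) ->
  is_derive a v f l.
Proof.
move=> r0 fC.
have cvgl : h^-1 *: ((f \o shift a) (h *: v) - f a) @[h --> 0^'] --> l.
  apply/cvgrPdist_le => e e0; near=> h.
  have h0 : h != 0 by near: h; exact: nbhs_dnbhs_neq.
  have hr : `|h| < r by near: h; exact: dnbhs0_lt.
  have he : `|C| * `|h| <= e.
    have C1 : 0 < `|C| + 1 by rewrite ltr_wpDl.
    have : `|h| < e / (`|C| + 1) by near: h; apply: dnbhs0_lt; rewrite divr_gt0.
    rewrite ltr_pdivlMr// mulrC => /ltW; apply: le_trans.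
    by rewrite ler_wpM2r// lerDl.
  rewrite /= [h *: v + a]addrC distrC.
  have -> : h^-1 *: (f (a + h *: v) - f a) - l =
      h^-1 * (f (a + h *: v) - f a - h * l).
    by rewrite mulrBr mulKf.
  rewrite normrM normfV ler_pdivrMl ?normr_gt0//.
  apply: (le_trans (fC _ hr)); apply: (le_trans (ler_norm _)).
  by rewrite normrM normrX expr2 mulrA mulrC ler_wpM2l.
apply: DeriveDef; first by apply/cvg_ex; exists l.
exact/cvg_lim.
Unshelve. all: by end_near. Qed.

Lemma has_derivative_continuous (V : normedModType R) (f : R -> V) x l :
  has_derivative f x l -> {for x, continuous f}.
Proof. by move=> [/derivable1_diffP/differentiable_continuous]. Qed.

Lemma has_derivative_within (V : normedModType R) (f df : R -> V) (a b : R) :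
  (forall s, s \in `[a, b] -> has_derivative f s (df s)) ->
  {within `[a, b], continuous f}.
Proof.
move=> fd; apply: derivable_within_continuous => x xab.
by have [] := fd x xab.
Qed.

Lemma mean_value_bound (f df : R -> R) (a b M : R) :
  a <= b -> (forall s, s \in `[a, b] -> has_derivative f s (df s)) ->
  (forall s, s \in `[a, b] -> `|df s| <= M) -> `|f b - f a| <= M * (b - a).
Proof.
move=> ab fd dM.
have cf : {within `[a, b], continuous f} by exact: has_derivative_within fd.
have fd' x : x \in `]a, b[ -> has_derivative f x (df x).
  by move=> xab; apply: fd; exact: subset_itv_oo_cc.
have [c cab fE] := MVT_segment ab fd' cf.
rewrite fE.
by rewrite normrM [`|b - a|]ger0_norm ?subr_ge0// ler_wpM2r ?subr_ge0// dM.
Qed.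

Lemma nonincreasing_has_derivative (f df : R -> R) (a b : R) :
  a <= b -> (forall s, s \in `[a, b] -> has_derivative f s (df s)) ->
  (forall s, s \in `]a, b[ -> df s <= 0) -> f b <= f a.
Proof.
rewrite le_eqVlt => /predU1P[->//|ab] fd d0.
have cf : {within `[a, b], continuous f} by exact: has_derivative_within fd.
have fd' x : x \in `]a, b[ -> has_derivative f x (df x).
  by move=> xab; apply: fd; exact: subset_itv_oo_cc.
have [c cab fE] := MVT ab fd' cf.
by rewrite -subr_le0 fE mulr_le0_ge0 ?d0// subr_ge0 ltW.
Qed.

Lemma has_derivative0_cst (f : R -> R) (a b : R) :
  (forall s, s \in `[a, b] -> has_derivative f s 0) ->
  forall s, s \in `[a, b] -> f s = f b.
Proof.
move=> fd s /[!in_itv]/= /andP[sa sb].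
have fd' u : u \in `[s, b] -> has_derivative f u (cst 0 u).
  rewrite in_itv/= => /andP[us ub]; apply: fd.
  by rewrite in_itv/= (le_trans sa us).
have := mean_value_bound sb fd' (M := 0).
rewrite mul0r normr_le0 subr_eq0 => /(_ _)/eqP->// u _.
by rewrite normr0.
Qed.

(* The sign of [f'] is only assumed where [f] is below the level [c]: this is
   the continuity argument that keeps nearby trajectories in a tube. *)
Lemma barrier (f df : R -> R) (c : R) :
  (forall s, s \in `[0, 1] -> has_derivative f s (df s)) ->
  (forall s, s \in `[0, 1] -> f s < c -> df s <= 0) ->
  f 0 < c -> forall s, s \in `[0, 1] -> f s <= f 0.
Proof.
move=> fd d0 f0c.
have decr s : s \in `[0, 1] -> (forall u, u \in `]0, s[ -> f u < c) ->
    f s <= f 0.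
  move=> /[!in_itv]/= /andP[s0 s1] us.
  have sub u : u \in `[0, s] -> u \in `[0, 1].
    by rewrite !in_itv/= => /andP[-> /le_trans->].
  apply: (nonincreasing_has_derivative s0) => u uos; first exact/fd/sub.
  by apply: d0; [exact/sub/subset_itv_oo_cc|exact: us].
suff lt_c s : s \in `[0, 1] -> f s < c.
  move=> s s01; apply: decr => // u /[!in_itv]/= /andP[u0 us].
  apply: lt_c; rewrite in_itv/= (ltW u0)/=.
  by move: s01; rewrite in_itv/= => /andP[_]; apply: le_trans (ltW us).
move=> s01; rewrite ltNge; apply/negP => cs.
(* [inf A] is the first time at which [f] reaches the level [c]. Up to it [f] is nonincreasing, so
   [f (inf A) <= f 0 < c]; by continuity [f] stays below [c] shortly afterwards, although [A] has
   points arbitrarily close to its infimum. *)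
pose A := [set u : R | u \in `[0, 1] /\ c <= f u].
have A0 : A !=set0 by exists s.
have lbA : has_inf A.
  by split=> //; exists 0 => u [/[!in_itv]/= /andP[]].
have ge0 : 0 <= inf A.
  by apply: lb_le_inf => // u [/[!in_itv]/= /andP[]].
have lei u : A u -> inf A <= u by move=> Au; apply: ge_inf => //; case: lbA.
have i01 : inf A \in `[0, 1].
  by rewrite in_itv/= ge0/= (le_trans (lei s _))//; move: s01 => /itvP->.
have below u : u \in `]0, inf A[ -> f u < c.
  rewrite in_itv/= => /andP[u0 ui]; rewrite ltNge; apply/negP => cu.
  have : A u.
    split=> //; rewrite in_itv/= (ltW u0)/=.
    by move: i01 => /[!in_itv]/= /andP[_]; apply: le_trans (ltW ui).
  by move=> /lei; rewrite leNgt ui.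
have fi := decr _ i01 below.
have : {for inf A, continuous f} by exact: has_derivative_continuous (fd _ i01).
move=> /cvgrPdist_lt/(_ (c - f 0)); rewrite subr_gt0 => /(_ f0c).
move=> /nbhs_ballP[e /= e0 he].
have [u Au ui] := inf_adherent e0 lbA.
have : ball (inf A) e u.
  rewrite /ball/= distrC ger0_norm ?subr_ge0 ?lei//; move: ui; lra.
move=> /he; rewrite distrC => /(le_lt_trans (ler_norm _)).
case: Au => _; lra.
Qed.

End RealAnalysis.


(** * The pairing of row vectors: bounds, continuity and product rule *)

Section Pairing.
Variables (R : realType) (n : nat).
Implicit Types u v w : 'rV[R]_n.

Lemma pairingC u v : pairing u v = pairing v u.
Proof. by apply: eq_bigr => i _; rewrite mulrC. Qed.

Lemma pairingDl u v w : pairing (u + v) w = pairing u w + pairing v w.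
Proof. by rewrite -big_split; apply: eq_bigr => i _; rewrite mxE mulrDl. Qed.

Lemma pairingZl a u v : pairing (a *: u) v = a * pairing u v.
Proof. by rewrite mulr_sumr; apply: eq_bigr => i _; rewrite mxE mulrA. Qed.

Lemma pairingNl u v : pairing (- u) v = - pairing u v.
Proof. by rewrite -scaleN1r pairingZl mulN1r. Qed.

Lemma pairingDr u v w : pairing u (v + w) = pairing u v + pairing u w.
Proof. by rewrite pairingC pairingDl !(pairingC u). Qed.

Lemma pairingZr a u v : pairing u (a *: v) = a * pairing u v.
Proof. by rewrite pairingC pairingZl pairingC. Qed.

Lemma pairingNr u v : pairing u (- v) = - pairing u v.
Proof. by rewrite pairingC pairingNl pairingC. Qed.

Lemma pairingBr u v w : pairing u (v - w) = pairing u v - pairing u w.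
Proof. by rewrite pairingDr pairingNr. Qed.

Lemma pairing0l u : pairing 0 u = 0.
Proof. by rewrite -(scale0r 0) pairingZl mul0r. Qed.

Lemma pairing0r u : pairing u 0 = 0.
Proof. by rewrite pairingC pairing0l. Qed.

Definition pairingE :=
  (pairingDl, pairingDr, pairingNl, pairingNr, pairingZl, pairingZr).

Lemma pairing_affine (a b u v : 'rV[R]_n) (h : R) :
  pairing (b + h *: v) (a + h *: u) =
  pairing b a + h * (pairing v a + pairing b u) + h ^+ 2 * pairing v u.
Proof. by rewrite !pairingE; ring. Qed.

Lemma ler_coord_norm u i : `|u 0 i| <= `|u|.
Proof.
rewrite [leRHS]/Num.Def.normr/= mx_normrE.
exact: (le_bigmax _ (fun i : 'I_1 * 'I_n => `|u i.1 i.2|) (0, i)).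
Qed.

Lemma rV_norm_le u (M : R) :
  0 <= M -> (forall i, `|u 0 i| <= M) -> `|u| <= M.
Proof.
move=> M0 uM; rewrite [leLHS]/Num.Def.normr/= mx_normrE bigmax_le//=.
by move=> [i j] _ /=; rewrite (ord1 i).
Qed.

Lemma norm_pairing_le u v : `|pairing u v| <= n%:R * (`|u| * `|v|).
Proof.
apply: (le_trans (ler_norm_sum _ _ _)).
apply: (@le_trans _ _ (\sum_(i < n) `|u| * `|v|)).
  by apply: ler_sum => i _; rewrite normrM ler_pM// ler_coord_norm.
by rewrite sumr_const card_ord mulr_natl.
Qed.

Lemma pairing_ge0 u : 0 <= pairing u u.
Proof. by apply: sumr_ge0 => i _; rewrite -expr2 sqr_ge0. Qed.

(** The norm here is the maximum norm, which is not smooth. The Gronwall argument follows the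
    Euclidean square [pairing u u] instead and returns to the norm through this inequality;
    [norm_pairing_le] is the converse comparison, at the cost of a factor n. *)
Lemma sqr_norm_le_pairing u : `|u| ^+ 2 <= pairing u u.
Proof.
rewrite -[leRHS]sqr_sqrtr ?pairing_ge0// lerXn2r ?nnegrE ?sqrtr_ge0//.
apply: rV_norm_le; first exact: sqrtr_ge0.
move=> i; rewrite -sqrtr_sqr ler_wsqrtr// /pairing (bigD1 i)//= -expr2 lerDl.
by apply: sumr_ge0 => j _; rewrite -expr2 sqr_ge0.
Qed.

Lemma pairing_self_eq0 u : pairing u u <= 0 -> u = 0.
Proof.
move=> /(le_trans (sqr_norm_le_pairing u)) u0.
by apply/eqP; rewrite -normr_eq0 -sqrf_eq0 eq_le u0 sqr_ge0.
Qed.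

Lemma pairing_delta u i : pairing (delta_mx 0 i) u = u 0 i.
Proof.
rewrite /pairing (bigD1 i)//= big1 ?addr0 ?mxE ?eqxx ?mul1r// => j ji.
by rewrite mxE (negbTE ji) andbF mul0r.
Qed.

Lemma has_derivative_rowP (f : R -> 'rV[R]_n) x l :
  has_derivative f x l <->
  forall i, has_derivative (fun s => f s 0 i) x (l 0 i).
Proof.
split=> [[fx fl] i|fi].
  split; first by move/derivable_mxP : fx.
  by rewrite -fl derive_mx// mxE.
have fx : derivable f x 1.
  by apply/derivable_mxP => i j; rewrite (ord1 i); have [] := fi j.
split=> //; rewrite derive_mx//; apply/rowP => i.
by rewrite mxE; have [] := fi i.
Qed.

Lemma has_derivative_pairing (f g : R -> 'rV[R]_n) x f' g' :
  has_derivative f x f' -> has_derivative g x g' ->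
  has_derivative (fun s => pairing (f s) (g s)) x
    (pairing f' (g x) + pairing (f x) g').
Proof.
move=> /has_derivative_rowP fx /has_derivative_rowP gx.
have fgx i : is_derive x (1 : R) ((fun s => f s 0 i) * (fun s => g s 0 i))
    (f x 0 i * g' 0 i + g x 0 i * f' 0 i).
  by apply: (@is_deriveM _ _ _ _ _ _ _ _ (fx i) (gx i)).
have := is_derive_sum fgx.
have -> : \sum_(i < n) (fun s => f s 0 i) * (fun s => g s 0 i) =
    (fun s => pairing (f s) (g s)).
  by apply/funext => s; rewrite fct_sumE.
congr (is_derive _ _ _ _).
rewrite big_split/= addrC; congr (_ + _); apply: eq_bigr => i _.
by rewrite mulrC.
Qed.

Lemma pairing_continuous (T : topologicalType) (f g : T -> 'rV[R]_n) x :
  {for x, continuous f} -> {for x, continuous g} ->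
  {for x, continuous (fun s => pairing (f s) (g s))}.
Proof.
move=> fx gx; apply: cvg_big => [|i _]; first exact: add_continuous.
apply: cvgM.
  exact: cvg_comp fx (@coord_continuous _ _ _ 0 i (f x)).
exact: cvg_comp gx (@coord_continuous _ _ _ 0 i (g x)).
Qed.

Lemma row_continuous (T : topologicalType) (f : T -> 'rV[R]_n) x :
  (forall i, {for x, continuous (fun s => f s 0 i)}) -> {for x, continuous f}.
Proof.
move=> fx; apply/cvgrPdist_le => e e0; near=> s.
apply: rV_norm_le; first exact: ltW.
move=> i; rewrite !mxE; move: i; near: s; apply: filter_forall => i.
by have /cvgrPdist_le/(_ e e0) := fx i.
Unshelve. all: by end_near. Qed.

End Pairing.

(** * Rules of differentiation *)

Section HasDerivative.
Variable R : realType.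

Lemma has_derivative_cst (V : normedModType R) (c : V) x :
  has_derivative (fun=> c : V) x 0.
Proof. exact: is_derive_cst. Qed.

Lemma has_derivativeD (V : normedModType R) (f g : R -> V) x f' g' :
  has_derivative f x f' -> has_derivative g x g' ->
  has_derivative (fun s => f s + g s) x (f' + g').
Proof. exact: is_deriveD. Qed.

Lemma has_derivativeB (V : normedModType R) (f g : R -> V) x f' g' :
  has_derivative f x f' -> has_derivative g x g' ->
  has_derivative (fun s => f s - g s) x (f' - g').
Proof. exact: is_deriveB. Qed.

Lemma has_derivativeZ (V : normedModType R) (f : R -> V) c x f' :
  has_derivative f x f' -> has_derivative (fun s => c *: f s) x (c *: f').
Proof. exact: is_deriveZ. Qed.

Lemma has_derivativeM (f g : R -> R) x f' g' :
  has_derivative f x f' -> has_derivative g x g' ->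
  has_derivative (fun s => f s * g s) x (f x * g' + g x * f').
Proof. exact: is_deriveM. Qed.

Lemma has_derivativeMl (f : R -> R) c x f' :
  has_derivative f x f' -> has_derivative (fun s => c * f s) x (c * f').
Proof. exact: has_derivativeZ. Qed.

Lemma has_derivative_comp (U V : normedModType R) (f : R -> U) (g : U -> V)
    x f' :
  has_derivative f x f' -> differentiable g (f x) ->
  has_derivative (g \o f) x ('d g (f x) f').
Proof.
move=> [/derivable1_diffP fx fE] gx.
have gfx : differentiable (g \o f) x by exact: differentiable_comp.
split; first exact/derivable1_diffP.
by rewrite deriveE// diff_comp//= -(deriveE _ fx) fE.
Qed.

Lemma has_derivative_scale (V : normedModType R) (f : R -> V) c x f' :
  has_derivative f (x * c) f' ->
  has_derivative (fun s => f (s * c)) x (c *: f').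
Proof.
move=> fx.
have mx : has_derivative (fun s : R => s * c) x c.
  have := has_derivativeM (is_derive_id x (1 : R)) (has_derivative_cst c x).
  by rewrite mulr0 add0r mulr1.
have fd : differentiable f (x * c).
  by apply/derivable1_diffP; have [] := fx.
have := has_derivative_comp mx fd; congr has_derivative.
rewrite -[c in 'd _ _ c]mulr1 linearZ/=; congr (_ *: _).
by rewrite -(deriveE _ fd); case: fx.
Qed.

Lemma has_derivative_near (V : normedModType R) (f g : R -> V) x f' :
  (\near x, f x = g x) -> has_derivative f x f' -> has_derivative g x f'.
Proof. exact: near_eq_is_derive. Qed.

Lemma has_derivative_unique (V : normedModType R) (f : R -> V) x a b :
  has_derivative f x a -> has_derivative f x b -> a = b.
Proof. by move=> [_ <-] [_ <-]. Qed.

End HasDerivative.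


(** * Primitives *)

Section Primitives.
Variable R : realType.

(** An integral with a fixed lower endpoint is differentiated only to the right of that endpoint.
    The lower endpoint therefore moves with [x], and the integral is normalised to vanish at 0,
    which makes it independent of the endpoint chosen. *)
Lemma primitive_exists (f : R -> R) :
  continuous f -> exists F : R -> R, forall x, has_derivative F x (f x).
Proof.
move=> cf.
pose P (N x : R) := \int[lebesgue_measure]_(s in `[- N, x]) f s.
have dP N x : - N < x -> has_derivative (P N) x (f x).
  move=> Nx; have xx1 : x < x + 1 by rewrite ltrDl.
  have fi : (@lebesgue_measure R).-integrable `[- N, x + 1] (EFin \o f).
    apply: continuous_compact_integrable; first exact: segment_compact.
    exact: continuous_subspaceT.
  have [Px PxE] := continuous_FTC1_closed xx1 fi Nx (cf x).
  by split; [exact: Px|rewrite -derive1E; exact: PxE].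
have shift N M x : 0 < N -> N <= M -> - N < x ->
    P M x - P M 0 = P N x - P N 0.
  move=> N0 NM Nx.
  have d0 s : - N < s -> has_derivative (fun u => P M u - P N u) s 0.
    move=> Ns; rewrite -(subrr (f s)).
    apply: has_derivativeB; apply: dP => //.
    by rewrite (le_lt_trans _ Ns)// lerN2.
  suff : P M x - P N x = P M 0 - P N 0 by lra.
  have [x0|/ltW x0] := leP x 0.
    apply: (@has_derivative0_cst _ (fun u => P M u - P N u) x 0) => [s|].
      by rewrite in_itv/= => /andP[xs _]; apply/d0/(lt_le_trans Nx).
    by rewrite in_itv/= lexx.
  apply/esym/(@has_derivative0_cst _ (fun u => P M u - P N u) 0 x) => [s|].
    by rewrite in_itv/= => /andP[s0 _]; apply/d0/(lt_le_trans _ s0); lra.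
  by rewrite in_itv/= lexx.
exists (fun x => P (`|x| + 1) x - P (`|x| + 1) 0) => x.
(* For [y] within distance 1 of [x] the bound [|y| + 1] is at most [|x| + 2], so the moving endpoint
   can be frozen near [x]. *)
apply: (@has_derivative_near _ _ (fun y => P (`|x| + 2) y - P (`|x| + 2) 0)).
  near=> y.
  have xy : `|y - x| < 1.
    by rewrite distrC; near: y; apply: nbhsx_ballx.
  have := lerB_dist y x; have := normr_ge0 y.
  move=> y0 yxd; apply: shift; [by lra|by lra|].
  by have := ler_norm (- y); rewrite normrN; lra.
rewrite -[f x]subr0; apply: has_derivativeB; last exact: has_derivative_cst.
by apply: dP; have := ler_norm (- x); rewrite normrN; lra.
Unshelve. all: by end_near. Qed.

(** Composition with this retraction onto [0, t] extends a function continuous at the points of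
    [0, t] to a continuous function on the line, as [primitive_exists] requires. *)
Definition clamp (t s : R) := Num.max 0 (Num.min s t).

Lemma clamp_id t s : s \in `[0, t] -> clamp t s = s.
Proof.
by rewrite in_itv/= /clamp => /andP[s0 st]; rewrite (min_idPl st) (max_idPr s0).
Qed.

Lemma clamp_itv t s : 0 <= t -> clamp t s \in `[0, t].
Proof.
by move=> t0; rewrite in_itv/= /clamp le_max lexx/= ge_max t0 ge_min lexx orbT.
Qed.

Lemma clamp_continuous t : continuous (clamp t).
Proof.
move=> s; apply: (@continuous_max R R (cst 0) (id \min cst t)).
  exact: cst_continuous.
apply: (@continuous_min R R id (cst t)); last exact: cst_continuous.
exact: cvg_id.
Qed.

Lemma comp_clamp_continuous (V : topologicalType) t (f : R -> V) :
  0 <= t -> (forall s, s \in `[0, t] -> {for s, continuous f}) ->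
  continuous (f \o clamp t).
Proof.
move=> t0 cf s; apply: continuous_comp; first exact: clamp_continuous.
exact/cf/clamp_itv.
Qed.

(** Replaces integrals by increments of a primitive, to be estimated with [mean_value_bound].
    Agreement of [g] with [f] is asked on the open interval because the integrand of the action
    contains [derive1 q]. *)
Lemma primitive_itv (t : R) (f : R -> R) :
  0 < t -> (forall s, s \in `[0, t] -> {for s, continuous f}) ->
  exists F : R -> R,
    (forall s, s \in `[0, t] -> has_derivative F s (f s)) /\
    (forall g, {in `]0, t[, g =1 f} ->
       \int[lebesgue_measure]_(s in `[0, t]) g s = F t - F 0).
Proof.
move=> t0 cf; have cfc := comp_clamp_continuous (ltW t0) cf.
have [F dF] := primitive_exists cfc.
have Ff s : s \in `[0, t] -> has_derivative F s (f s).
  by move=> st; have := dF s; rewrite /= clamp_id.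
exists F; split=> // g gf.
have gfc : {in `]0, t[, g =1 f \o clamp t}.
  by move=> s st; rewrite /= clamp_id ?gf//; exact: subset_itv_oo_cc.
have mf : measurable_fun `]0, t[ (f \o clamp t).
  apply: measurable_funTS; exact: continuous_measurable_fun.
have mg : measurable_fun `]0, t[ g.
  apply: eq_measurable_fun mf => s /[!inE] st.
  by rewrite gfc.
have FTC : (\int[lebesgue_measure]_(s in `[0%R, t]) ((f \o clamp t) s)%:E =
    (F t)%:E - (F 0)%:E)%E.
  apply: continuous_FTC2 => //.
  - exact: continuous_subspaceT.
  - split.
    + by move=> s _; have [] := dF s.
    + exact/cvg_at_right_filter/has_derivative_continuous/dF.
    + exact/cvg_at_left_filter/has_derivative_continuous/dF.
  - by move=> s _; rewrite derive1E; have [] := dF s.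
rewrite /Rintegral integral_itv_bndoo; last exact/measurable_EFinP.
have -> : (\int[lebesgue_measure]_(s in `]0%R, t[) (g s)%:E =
    \int[lebesgue_measure]_(s in `]0%R, t[) ((f \o clamp t) s)%:E)%E.
  by apply: eq_integral => s /[!inE] st; rewrite gfc.
rewrite -(@integral_itv_bndoo _ _ _ _ true false) ?FTC//.
exact/measurable_EFinP.
Qed.

Lemma row_primitive (n : nat) (g : R -> 'rV[R]_n) (c : R) :
  continuous g ->
  exists2 G : R -> 'rV[R]_n, forall x, has_derivative G x (g x) & G c = 0.
Proof.
move=> cg.
have cgi i : continuous (fun s => g s 0 i).
  move=> s; exact: cvg_comp (cg s) (@coord_continuous _ _ _ 0 i (g s)).
have /choice[F dF] : forall i, exists F : R -> R,
  forall x, has_derivative F x (g x 0 i) by move=> i; exact: primitive_exists.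
have dG x : has_derivative (fun s => \row_i F i s) x (g x).
  apply/has_derivative_rowP => i.
  have -> : (fun s => (\row_i F i s) 0 i) = F i.
    by apply/funext => s; rewrite mxE.
  exact: dF.
exists (fun s => (\row_i F i s) - (\row_i F i c)); last by rewrite subrr.
move=> x; rewrite -[g x]subr0; apply: has_derivativeB; first exact: dG.
exact: has_derivative_cst.
Qed.

End Primitives.

(** * Curves of class C^2 and their action *)

Section ContinuouslyDifferentiable.
Variables (R : realType) (V : normedModType R).
Implicit Types f g : R -> V.

Lemma has_derivative_diff f x l : has_derivative f x l -> differentiable f x.
Proof. by move=> [/derivable1_diffP]. Qed.

Lemma has_derivative_diff1 f x l : has_derivative f x l -> 'd f x 1 = l.
Proof.
by move=> fx; rewrite -(deriveE (1 : R) (has_derivative_diff fx)); case: fx.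
Qed.

Lemma has_derivative_derive f x l v : has_derivative f x l -> 'D_v f x = v *: l.
Proof.
move=> fx; have fd := has_derivative_diff fx.
by rewrite deriveE// -[v in LHS]mulr1 linearZ/= -deriveE//; case: fx => _ ->.
Qed.

Lemma has_derivative_scalel (v : V) (x : R) :
  has_derivative (fun s : R => s *: v) x v.
Proof.
have [dv dvE] := is_diff_scalel x v.
split; first exact/derivable1_diffP.
by rewrite (deriveE _ dv) dvE scale1r.
Qed.

(** [Ck] quantifies over all directions even on the line, where a directional derivative is the
    ordinary one times a scalar; hence the factors [v] and [w]. *)
Lemma C2_of_has_derivative (f f1 f2 : R -> V) :
  (forall x, has_derivative f x (f1 x)) ->
  (forall x, has_derivative f1 x (f2 x)) -> continuous f2 -> Ck 2 setT f.
Proof.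
move=> df df1 cf2; split=> [x _|v]; first exact: has_derivative_diff (df x).
have -> : (fun x => 'D_v f x) = (fun x => v *: f1 x).
  by apply/funext => x; exact: has_derivative_derive.
have dv x : has_derivative (fun x => v *: f1 x) x (v *: f2 x).
  exact: has_derivativeZ.
split=> [x _|w]; first exact: has_derivative_diff (dv x).
have -> : (fun x => 'D_w (fun x => v *: f1 x) x) = (fun x => w *: (v *: f2 x)).
  by apply/funext => x; exact: has_derivative_derive.
by move=> x _; exact: cvgZl_tmp (cvgZl_tmp (cf2 x)).
Qed.

Lemma C2_derivative f : Ck 2 setT f ->
  (forall x, has_derivative f x ('D_1 f x)) /\ continuous ('D_1 f).
Proof.
move=> [fd f1]; split=> [x|x].
  by apply/derivableP/derivable1_diffP/fd.
by have [f1d _] := f1 1; exact/differentiable_continuous/f1d.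
Qed.

End ContinuouslyDifferentiable.

(* Only the values of [q] and [p] on [0, t] matter: those of [derive1 q] at the
   endpoints form a null set. *)
Lemma action_primitive (R : realType) (n : nat)
    (H : 'rV[R]_n * 'rV[R]_n -> R) (t : R) (a b a1 : R -> 'rV[R]_n) :
  0 < t -> (forall s, has_derivative a s (a1 s)) -> continuous a1 ->
  continuous b ->
  (forall s, s \in `[0, t] -> {for (a s, b s), continuous H}) ->
  exists F : R -> R,
    (forall s, s \in `[0, t] ->
       has_derivative F s (pairing (b s) (a1 s) - H (a s, b s))) /\
    (forall q p : R -> 'rV[R]_n,
       (forall s, s \in `[0, t] -> q s = a s /\ p s = b s) ->
       action H t q p = pairing (b t) (a t) - (F t - F 0)).
Proof.
move=> t0 da ca1 cb cH.
have ca : continuous a by move=> s; exact: has_derivative_continuous (da s).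
have [s st|F [dF intF]] := @primitive_itv R t
    (fun s => pairing (b s) (a1 s) - H (a s, b s)) t0.
  apply: cvgB; first exact: pairing_continuous (cb s) (ca1 s).
  exact: (cvg_comp _ _ (cvg_pair (ca s) (cb s)) (cH s st)).
exists F; split=> // q p qp.
have tt : t \in `[0, t] by rewrite in_itv/= lexx ltW.
rewrite /action (qp t tt).1 (qp t tt).2; congr (_ - _); apply: intF => s st.
have [-> ->] := qp s (subset_itv_oo_cc st).
congr (pairing _ _ - _).
suff : has_derivative q s (a1 s) by rewrite derive1E; case.
apply: has_derivative_near (da s).
have := near_in_itvoo st; apply: filterS => u ut.
by have [-> _] := qp u (subset_itv_oo_cc ut).
Qed.


(** * Quadratic expansion of the Hamiltonian along a curve *)

Section PhaseSpace.
Variables (R : realType) (n : nat).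
Notation phase := ('rV[R]_n * 'rV[R]_n)%type.
Implicit Types (f : phase -> R) (z w : phase) (U : set phase).

Definition gradq f z : 'rV[R]_n := \row_i 'D_(delta_mx 0 i, 0) f z.
Definition gradp f z : 'rV[R]_n := \row_i 'D_(0, delta_mx 0 i) f z.

Lemma open_cylinder (Q : set 'rV[R]_n) :
  open Q -> open (Q `*` [set: 'rV[R]_n]).
Proof.
move=> oQ; rewrite openE => -[x y] [/= Qx _]; exists (Q, setT) => //=.
by split; [exact: open_nbhs_nbhs|exact: filterT].
Qed.

Lemma norm_fst_le w : `|w.1| <= `|w|.
Proof. by rewrite [leRHS]prod_normE le_max lexx. Qed.

Lemma norm_snd_le w : `|w.2| <= `|w|.
Proof. by rewrite [leRHS]prod_normE le_max lexx orbT. Qed.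

Lemma diff_gradE f z w : differentiable f z ->
  'd f z w = pairing w.1 (gradq f z) + pairing w.2 (gradp f z).
Proof.
move=> fz; have {1}-> : w = \sum_i w.1 0 i *: (delta_mx 0 i, 0) +
    \sum_i w.2 0 i *: (0, delta_mx 0 i).
  case: w => u v /=; apply/pair_equal_spec; split=> /=.
    rewrite {1}(row_sum_delta u) !raddf_sum/= [X in _ + X]big1 ?addr0//.
    by move=> i _; rewrite scaler0.
  rewrite {1}(row_sum_delta v) !raddf_sum/= [X in X + _]big1 ?add0r//.
  by move=> i _; rewrite scaler0.
rewrite linearD !linear_sum/=; congr (_ + _); apply: eq_bigr => i _.
  by rewrite linearZ/= -deriveE// mxE.
by rewrite linearZ/= -deriveE// mxE.
Qed.

Lemma has_derivative_phase f (a b : R -> 'rV[R]_n) s a' b' :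
  has_derivative a s a' -> has_derivative b s b' ->
  differentiable f (a s, b s) ->
  has_derivative (fun u => f (a u, b u)) s
    (pairing a' (gradq f (a s, b s)) + pairing b' (gradp f (a s, b s))).
Proof.
move=> da db fz.
have dab : has_derivative (fun u => (a u, b u)) s (a', b').
  have das := has_derivative_diff da; have dbs := has_derivative_diff db.
  split; first exact/derivable1_diffP/differentiable_pair.
  rewrite (deriveE _ (differentiable_pair das dbs)).
  have -> : 'd (fun u => (a u, b u)) s 1 = ('d a s 1, 'd b s 1).
    by rewrite (diff_pair das dbs).
  have E1 := has_derivative_diff1 da; have E2 := has_derivative_diff1 db.
  apply: (congr2 pair); [exact: E1|exact: E2].
by have := has_derivative_comp dab fz; rewrite (diff_gradE _ fz).
Qed.

Lemma norm_diff_le f z w : differentiable f z ->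
  `|'d f z w| <= n%:R * (`|gradq f z| + `|gradp f z|) * `|w|.
Proof.
move=> fz; rewrite diff_gradE// (le_trans (ler_normD _ _))// mulrDr mulrDl.
apply: lerD; apply: (le_trans (norm_pairing_le _ _)).
  by rewrite -mulrA ler_wpM2l// mulrC ler_wpM2l// norm_fst_le.
by rewrite -mulrA ler_wpM2l// mulrC ler_wpM2l// norm_snd_le.
Qed.

Lemma gradq_continuous f z :
  (forall v, {for z, continuous ('D_v f)}) -> {for z, continuous (gradq f)}.
Proof.
move=> fz; apply: row_continuous => i.
have -> : (fun s => gradq f s 0 i) = 'D_(delta_mx 0 i, 0) f.
  by apply/funext => s; rewrite mxE.
exact: fz.
Qed.

Lemma gradp_continuous f z :
  (forall v, {for z, continuous ('D_v f)}) -> {for z, continuous (gradp f)}.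
Proof.
move=> fz; apply: row_continuous => i.
have -> : (fun s => gradp f s 0 i) = 'D_(0, delta_mx 0 i) f.
  by apply/funext => s; rewrite mxE.
exact: fz.
Qed.

Lemma continuous_bounded_near (T : topologicalType) (W : normedModType R)
    (g : T -> W) (z : T) :
  {for z, continuous g} -> \forall x \near z, `|g x| <= `|g z| + 1.
Proof.
move=> /cvgrPdist_le/(_ 1 ltr01); apply: filterS => x.
have := ler_dist_dist (g z) (g x); have := ler_norm (`|g x| - `|g z|).
by rewrite [`|_ - `|g z| |]distrC; lra.
Qed.

Lemma has_derivative_segment f z w (theta : R) :
  differentiable f (z + theta *: w) ->
  has_derivative (fun u => f (z + u *: w)) theta ('d f (z + theta *: w) w).
Proof.
move=> fz.
have dz : has_derivative (fun u : R => z + u *: w) theta w.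
  have := has_derivativeD (has_derivative_cst z theta)
    (has_derivative_scalel w theta).
  by rewrite add0r.
exact: (has_derivative_comp dz fz).
Qed.

(** The differential is bounded near [z0], and the mean value theorem applies on segments. A single
    [r] is both the radius and, through [r^-1], the constant: such statements hold for all small
    [r], so they can be intersected and made uniform as filter statements. *)
Lemma locally_lipschitz U f z0 :
  open U -> (forall z, U z -> differentiable f z) -> U z0 ->
  (forall v, {for z0, continuous ('D_v f)}) ->
  \forall z \near z0 & r \near 0^'+, forall w, `|w| < r ->
    U (z + w) /\ `|f (z + w) - f z| <= r^-1 * `|w|.
Proof.
move=> oU fd Uz0 cf.
pose M := n%:R * ((`|gradq f z0| + 1) + (`|gradp f z0| + 1)).
have M0 : 0 <= M by rewrite mulr_ge0// !addr_ge0.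
have [e /= e0 he] : exists2 e : R, 0 < e & forall z, `|z0 - z| < e ->
    U z /\ forall w, `|'d f z w| <= M * `|w|.
  have : \forall z \near z0, U z /\ forall w, `|'d f z w| <= M * `|w|.
    have := continuous_bounded_near (gradq_continuous cf).
    have := continuous_bounded_near (gradp_continuous cf).
    have := open_nbhs_nbhs (conj oU Uz0).
    apply: filterS3 => z Uz pz qz; split=> // w.
    apply: (le_trans (norm_diff_le _ (fd _ Uz))).
    apply: ler_wpM2r; first exact: normr_ge0.
    apply: ler_wpM2l; first exact: ler0n.
    exact: lerD qz pz.
  by move=> /nbhs_normP[e /= e0 he]; exists e => // z /he.
(* Half of [e] is for the distance from [z0] to [z], half for the length of [w]; the second bound on
   [r] gives [M <= r^-1]. *)
exists (ball z0 (e / 2), [set r | 0 < r < Num.min (e / 2) (M + 1)^-1]).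
  split; first by apply: nbhsx_ballx; rewrite divr_gt0.
  have m0 : 0 < Num.min (e / 2) (M + 1)^-1.
    by rewrite lt_min divr_gt0//= invr_gt0 ltr_wpDl.
  near=> r; apply/andP; split; near: r; first exact: nbhs_right_gt.
  exact: nbhs_right_lt.
move=> [z r] [/= zz0 /andP[r0]]; rewrite lt_min => /andP[re rM] w wr.
have near_seg (u : R) : u \in `[0, 1] -> `|z0 - (z + u *: w)| < e.
  rewrite in_itv/= => /andP[u0 u1].
  rewrite opprD addrA (le_lt_trans (ler_normB _ _))//.
  move: zz0; rewrite -ball_normE/= => zz0.
  have : `|u *: w| <= `|w|.
    by rewrite normrZ ger0_norm// ler_piMl.
  lra.
have in1 : 1 \in `[0 : R, 1] by rewrite in_itv/= ler01 lexx.
split; first by have [] := he _ (near_seg 1 in1); rewrite scale1r.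
have := @mean_value_bound R (fun u => f (z + u *: w))
  (fun u => 'd f (z + u *: w) w) 0 1 (M * `|w|) ler01.
rewrite subr0 mulr1 scale1r scale0r addr0 => /(_ _ _)/le_trans; apply.
- by move=> u /near_seg/he[Uu _]; apply/has_derivative_segment/fd.
- by move=> u /near_seg/he[_]; apply.
apply: ler_wpM2r; first exact: normr_ge0.
have : M + 1 < r^-1 by rewrite -[M + 1]invrK ltf_pV2 ?posrE ?invr_gt0 ?ltr_wpDl.
lra.
Unshelve. all: by end_near. Qed.

Lemma locally_gradient_lipschitz U f z0 :
  open U -> Ck 2 U f -> U z0 ->
  \forall z \near z0 & r \near 0^'+,
    [/\ `|gradq f z| <= r^-1, `|gradp f z| <= r^-1 &
       forall w, `|w| < r ->
         [/\ U (z + w), `|gradq f (z + w) - gradq f z| <= r^-1 * `|w| &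
             `|gradp f (z + w) - gradp f z| <= r^-1 * `|w|]].
Proof.
move=> oU [fd f2] Uz0.
have cf v : {for z0, continuous ('D_v f)}.
  by have [fvd _] := f2 v; apply/differentiable_continuous/fvd.
have lip v : \forall z \near z0 & r \near 0^'+, forall w, `|w| < r ->
    U (z + w) /\ `|'D_v f (z + w) - 'D_v f z| <= r^-1 * `|w|.
  have [fvd fv1] := f2 v; apply: (locally_lipschitz oU fvd Uz0) => u.
  by have := fv1 u; apply.
have bound (g : phase -> 'rV[R]_n) : {for z0, continuous g} ->
    \forall z \near z0 & r \near 0^'+, `|g z| <= r^-1.
  move=> /continuous_bounded_near gz.
  exists ([set z | `|g z| <= `|g z0| + 1], [set r | 0 < r < (`|g z0| + 1)^-1]).
    split=> //; near=> r; apply/andP; split; near: r.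
      exact: nbhs_right_gt.
    by apply: nbhs_right_lt; rewrite invr_gt0 ltr_wpDl.
  move=> [z r] [/= zz0 /andP[r0 rM]]; apply: (le_trans zz0).
  by rewrite -[leLHS]invrK lef_pV2 ?posrE ?invr_gt0 ?ltr_wpDl// ltW.
have FF : Filter (filter_prod (nbhs z0) (nbhs (0 : R)^'+)).
  exact: filter_prod_filter.
have lips (e : 'I_n -> phase) : \forall z \near z0 & r \near 0^'+,
    forall i w, `|w| < r ->
      U (z + w) /\ `|'D_(e i) f (z + w) - 'D_(e i) f z| <= r^-1 * `|w|.
  by apply: (@filter_forall _ _ _ _ FF) => i; exact: lip.
have lipq := lips (fun i => (delta_mx 0 i, 0)).
have lipp := lips (fun i => (0, delta_mx 0 i)).
have bq := bound _ (gradq_continuous cf).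
have bp := bound _ (gradp_continuous cf).
(* For [n = 0] there are no coordinate directions, so membership in [U] is taken from the direction
   0. *)
have lipU := lip 0.
have r_gt0 : \forall z \near z0 & r \near 0^'+, (0 : R) < r.
  exists (setT, [set r : R | 0 < r]) => /=.
    by split; [exact: filterT|exact: nbhs_right_gt].
  by move=> [z r] [].
have fI A B := @filterI _ _ FF A B.
have := fI _ _ (fI _ _ r_gt0 lipU) (fI _ _ (fI _ _ lipq lipp) (fI _ _ bq bp)).
apply: (@filterS _ _ FF) => -[z r] /= [[r0 zU] [[zq zp] [gq gp]]].
split=> // w wr.
have rw0 : 0 <= r^-1 * `|w| by rewrite mulr_ge0// invr_ge0 ltW.
split; first by have [] := zU w wr.
  apply: rV_norm_le => // i; rewrite !mxE.
  by have [] := zq i w wr.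
apply: rV_norm_le => // i; rewrite !mxE.
by have [] := zp i w wr.
Unshelve. all: by end_near. Qed.

(** The base point [z] lies on the reference curve and [z + w] on a nearby one; [L] and [r] are
    chosen once for the whole curve in [compact_tube]. *)
Definition tube U f (L r : R) z := [/\ `|gradq f z| <= L, `|gradp f z| <= L &
  forall w, `|w| < r ->
    [/\ U (z + w), `|gradq f (z + w) - gradq f z| <= L * `|w|,
        `|gradp f (z + w) - gradp f z| <= L * `|w| &
        `|f (z + w) - f z - (pairing w.1 (gradq f z) + pairing w.2 (gradp f z))|
          <= L * `|w| ^+ 2]].

(** After subtraction of the linear term, the derivative along the segment pairs [w] with an
    increment of the gradient. The factor 2n is one [n] from [norm_pairing_le] for each of the q and
    p components. *)
Lemma taylor_of_gradient_lipschitz U f (L r : R) z :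
  (forall z, U z -> differentiable f z) -> 0 <= L ->
  (forall w, `|w| < r ->
     [/\ U (z + w), `|gradq f (z + w) - gradq f z| <= L * `|w| &
         `|gradp f (z + w) - gradp f z| <= L * `|w|]) ->
  forall w, `|w| < r ->
    `|f (z + w) - f z - (pairing w.1 (gradq f z) + pairing w.2 (gradp f z))|
      <= 2 * n%:R * L * `|w| ^+ 2.
Proof.
move=> fd L0 lip w wr.
pose c := pairing w.1 (gradq f z) + pairing w.2 (gradp f z).
have seg (u : R) : u \in `[0, 1] -> `|u *: w| <= `|w|.
  by rewrite in_itv/= => /andP[u0 u1]; rewrite normrZ ger0_norm// ler_piMl.
have := @mean_value_bound R (fun u => f (z + u *: w) - u *: c)
  (fun u => 'd f (z + u *: w) w - c) 0 1 (2 * n%:R * L * `|w| ^+ 2) ler01.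
rewrite subr0 mulr1 !scale1r !scale0r addr0 subr0.
rewrite [f (z + w) - c - f z]addrAC => /(_ _ _)/le_trans; apply => //.
- move=> u /seg uw; apply: has_derivativeB.
    apply: has_derivative_segment; apply: fd.
    by have [] := lip _ (le_lt_trans uw wr).
  exact: has_derivative_scalel.
- move=> u /seg uw; have [Uu lq lp] := lip _ (le_lt_trans uw wr).
  rewrite diff_gradE; last exact: fd.
  have -> : pairing w.1 (gradq f (z + u *: w)) +
      pairing w.2 (gradp f (z + u *: w)) - c =
      pairing w.1 (gradq f (z + u *: w) - gradq f z) +
      pairing w.2 (gradp f (z + u *: w) - gradp f z).
    by rewrite !pairingBr addrACA opprD.
  have bnd (v g : 'rV[R]_n) : `|v| <= `|w| -> `|g| <= L * `|u *: w| ->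
      `|pairing v g| <= n%:R * L * `|w| ^+ 2.
    move=> vw gw; apply: (le_trans (norm_pairing_le _ _)).
    rewrite -mulrA ler_wpM2l// expr2 mulrCA ler_pM//.
    by rewrite (le_trans gw)// ler_wpM2l.
  apply: (le_trans (ler_normD _ _)).
  have bq := bnd _ _ (norm_fst_le w) lq; have bp := bnd _ _ (norm_snd_le w) lp.
  apply: (le_trans (lerD bq bp)).
  by rewrite -mulr2n -[leLHS]mulr_natl !mulrA.
Qed.

(** Compactness of [0, t], in its covering form for filters, turns the bounds valid near each point
    for all small [r] into bounds with one [r] along the curve. *)
Lemma compact_tube U f (t : R) (c : R -> phase) :
  open U -> Ck 2 U f -> continuous c -> (forall s, s \in `[0, t] -> U (c s)) ->
  exists L r : R, [/\ 0 < L, 0 < r &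
    forall s, s \in `[0, t] -> tube U f L r (c s)].
Proof.
move=> oU f2 cc Uc.
pose P (r s : R) :=
  [/\ `|gradq f (c s)| <= r^-1, `|gradp f (c s)| <= r^-1 &
     forall w, `|w| < r ->
       [/\ U (c s + w), `|gradq f (c s + w) - gradq f (c s)| <= r^-1 * `|w| &
         `|gradp f (c s + w) - gradp f (c s)| <= r^-1 * `|w|]].
have cov := (compact_near_coveringP _).1 (@segment_compact R 0 t).
have near_r : \forall r \near 0^'+, `[0, t] `<=` P r.
  apply: cov => s /= st.
  have [[A B] /= [cA B0] AB] := locally_gradient_lipschitz oU f2 (Uc s st).
  exists (c @^-1` A, B); first by split=> //; exact: cc.
  by move=> [s' r] [/= As Br]; exact: (AB (c s', r)).
have [r r0 tr] : exists2 r : R, 0 < r & forall s, s \in `[0, t] -> P r s.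
  near (0 : R)^'+ => r; exists r; first by near: r; exact: nbhs_right_gt.
  by near: r; exact: near_r.
(* Dominates both [r^-1], for the gradients, and the Taylor constant [2 * n%:R * r^-1]. *)
pose L := (2 * n%:R + 1) * r^-1.
have ri0 : 0 < r^-1 by rewrite invr_gt0.
have n0 : 0 <= n%:R :> R by [].
have rL : r^-1 <= L.
  by apply: ler_peMl; [exact: ltW|rewrite lerDr mulr_ge0].
exists L, r; split=> //; first exact: lt_le_trans rL.
move=> s st; have [bq bp lip] := tr s st.
split; [exact: (le_trans bq rL)|exact: (le_trans bp rL)|] => w wr.
have [Uw lq lp] := lip w wr.
split=> //.
- by rewrite (le_trans lq)// ler_wpM2r.
- by rewrite (le_trans lp)// ler_wpM2r.
have [fd _] := f2.
apply: (le_trans (taylor_of_gradient_lipschitz fd (ltW ri0) lip wr)).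
apply: ler_wpM2r; first exact: exprn_ge0.
by apply: ler_wpM2r; [exact: ltW|rewrite lerDl].
Unshelve. all: by end_near. Qed.


End PhaseSpace.


(** * Stationary curves solve Hamilton's equations *)

Lemma continuous_bounded_itv (R : realType) (W : normedModType R) (g : R -> W)
    (t : R) : 0 <= t -> continuous g ->
  exists2 M, 0 <= M & forall s, s \in `[0, t] -> `|g s| <= M.
Proof.
move=> t0 cg.
have cn : {within `[0, t], continuous (fun s => `|g s|)}.
  by apply: continuous_subspaceT => s; exact: cvg_norm (cg s).
have [c ct cM] := EVT_max t0 cn.
by exists `|g c|.
Qed.

Lemma continuous_eq0_itvcc (R : realType) (W : normedModType R) (g : R -> W)
    (t : R) : 0 < t -> continuous g -> (forall s, s \in `]0, t[ -> g s = 0) ->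
  forall s, s \in `[0, t] -> g s = 0.
Proof.
move=> t0 cg g0 s st; apply/eqP; rewrite -normr_le0; apply/ler_addgt0Pl => e e0.
rewrite addr0.
move: st; rewrite in_itv/= => /andP[s0]; rewrite le_eqVlt => /orP[/eqP sE|s_t].
  have /cvgrPdist_le/(_ e e0) := cvg_at_left_filter (cg s).
  move=> H; near s^'- => u.
  have <- : g s - g u = g s.
    rewrite (g0 u) ?subr0// in_itv/=; apply/andP; split.
      by near: u; apply: nbhs_left_gt; rewrite sE.
    by rewrite -sE; near: u; exact: nbhs_left_lt.
  by near: u.
have /cvgrPdist_le/(_ e e0) := cvg_at_right_filter (cg s).
move=> H; near s^'+ => u.
have <- : g s - g u = g s.
  rewrite (g0 u) ?subr0// in_itv/=; apply/andP; split.
    by apply: (le_lt_trans s0); near: u; exact: nbhs_right_gt.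
  by near: u; exact: nbhs_right_lt.
by near: u.
Unshelve. all: by end_near. Qed.

Section CalculusOfVariations.
Variables (R : realType) (n : nat).
Implicit Types (a b u v : R -> 'rV[R]_n).

(* Testing [g] against its own double primitive [G2] (which is C^2 when [g] is
   merely continuous) gives [\int <G2, g> = - \int |G1|^2]. *)
Lemma double_primitive_eq0 (t : R) (g G1 G2 : R -> 'rV[R]_n) (Phi : R -> R) :
  0 < t -> continuous g ->
  (forall s, has_derivative G1 s (g s)) ->
  (forall s, has_derivative G2 s (G1 s)) ->
  (forall s, s \in `[0, t] -> has_derivative Phi s (pairing (G2 s) (g s))) ->
  Phi t = Phi 0 -> pairing (G1 0) (G2 0) = 0 -> pairing (G1 t) (G2 t) = 0 ->
  forall s, s \in `[0, t] -> g s = 0.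
Proof.
move=> t0 cg dG1 dG2 dPhi Phit G0 Gt; apply: continuous_eq0_itvcc => //.
(* K' = - |G1|^2 <= 0, while the boundary hypotheses give equal values at 0 and t. So [K] is
   constant, [G1] vanishes inside the interval, and with it its derivative [g]. *)
pose K s := Phi s - pairing (G1 s) (G2 s).
have dK s : s \in `[0, t] -> has_derivative K s (- pairing (G1 s) (G1 s)).
  move=> st.
  have := has_derivativeB (dPhi s st) (has_derivative_pairing (dG1 s) (dG2 s)).
  by rewrite opprD addrA [pairing (g s) _]pairingC subrr sub0r.
have K0t : K 0 = K t by rewrite /K G0 Gt Phit.
have Kmono s1 s2 : 0 <= s1 -> s1 <= s2 -> s2 <= t -> K s2 <= K s1.
  move=> s10 s12 s2t.
  apply: (nonincreasing_has_derivative s12) => [s|s _].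
    rewrite in_itv/= => /andP[ss1 ss2]; apply: dK.
    by rewrite in_itv/= (le_trans s10)// (le_trans ss2).
  by rewrite oppr_le0 pairing_ge0.
have Kcst s : s \in `[0, t] -> K s = K 0.
  rewrite in_itv/= => /andP[s0 st]; apply/eqP; rewrite eq_le {2}K0t.
  by rewrite !Kmono.
have G1_eq0 s : s \in `]0, t[ -> G1 s = 0.
  move=> st; apply: pairing_self_eq0.
  rewrite -oppr_ge0 le_eqVlt; apply/orP; left.
  apply/eqP; apply: (has_derivative_unique (f := K) (x := s)); last first.
    exact/dK/subset_itv_oo_cc.
  apply: (@has_derivative_near _ _ (fun=> K 0)); last exact: has_derivative_cst.
  have := near_in_itvoo st; apply: filterS => y yt.
  by rewrite Kcst//; exact: subset_itv_oo_cc.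
move=> s st; apply: (has_derivative_unique (dG1 s)).
apply: (@has_derivative_near _ _ (fun=> 0)); last exact: has_derivative_cst.
by have := near_in_itvoo st; apply: filterS => y yt; rewrite G1_eq0.
Qed.

(** The linear part of the integrand is kept as a primitive [Psi], ready for [double_primitive_eq0].
    The derivative is taken of the very function that occurs in [stationary], so uniqueness of
    derivatives equates it with 0. *)
Lemma first_variation (Q : set 'rV[R]_n) (H : 'rV[R]_n * 'rV[R]_n -> R) (t : R)
    (q p a b a1 u v u1 : R -> 'rV[R]_n) :
  open Q -> Ck 2 (Q `*` setT) H -> 0 < t ->
  (forall s, has_derivative a s (a1 s)) -> continuous a1 -> continuous b ->
  (forall s, has_derivative u s (u1 s)) -> continuous u1 -> continuous v ->
  (forall s, s \in `[0, t] -> [/\ q s = a s, p s = b s & Q (a s)]) ->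
  exists Psi : R -> R,
    (forall s, s \in `[0, t] -> has_derivative Psi s
       (pairing (v s) (a1 s) + pairing (b s) (u1 s) -
        (pairing (u s) (gradq H (a s, b s)) +
         pairing (v s) (gradp H (a s, b s))))) /\
    is_derive (0 : R) (1 : R)
      (fun e : R => action H t (fun s => q s + e *: u s)
                               (fun s => p s + e *: v s))
      (pairing (v t) (a t) + pairing (b t) (u t) - (Psi t - Psi 0)).
Proof.
move=> oQ H2 t0 da ca1 cb du cu1 cv qp.
have ca : continuous a by move=> s; exact: has_derivative_continuous (da s).
have cu : continuous u by move=> s; exact: has_derivative_continuous (du s).
have oU := open_cylinder oQ.
have cab : continuous (fun s => (a s, b s)).
  by move=> s; exact: cvg_pair (ca s) (cb s).
have Uab s : s \in `[0, t] -> (Q `*` [set: 'rV[R]_n]) (a s, b s).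
  by move=> st; have [_ _] := qp s st.
have [dH DH] := H2.
have cDH z w : (Q `*` [set: 'rV[R]_n]) z -> {for z, continuous ('D_w H)}.
  move=> Uz; have [dw _] := DH w; apply: differentiable_continuous.
  exact: dw.
have [L [r [L0 r0 tub]]] := compact_tube oU H2 cab Uab.
have [M1 M10 uM] := continuous_bounded_itv (ltW t0) cu.
have [M2 M20 vM] := continuous_bounded_itv (ltW t0) cv.
have [M3 M30 u1M] := continuous_bounded_itv (ltW t0) cu1.
pose M := M1 + M2 + M3.
have M0 : 0 <= M by rewrite !addr_ge0.
have bounds s : s \in `[0, t] -> [/\ `|u s| <= M, `|v s| <= M & `|u1 s| <= M].
  move=> st; have := uM s st; have := vM s st; have := u1M s st.
  by rewrite /M; split; lra.
have [s st|Psi [dPsi _]] := @primitive_itv R t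
    (fun s => pairing (v s) (a1 s) + pairing (b s) (u1 s) -
        (pairing (u s) (gradq H (a s, b s)) +
         pairing (v s) (gradp H (a s, b s)))) t0.
  have cq : {for s, continuous (fun s => gradq H (a s, b s))}.
    have gc := gradq_continuous (fun w => cDH _ w (Uab s st)).
    exact: (cvg_comp _ _ (cab s) gc).
  have cp : {for s, continuous (fun s => gradp H (a s, b s))}.
    have gc := gradp_continuous (fun w => cDH _ w (Uab s st)).
    exact: (cvg_comp _ _ (cab s) gc).
  apply: cvgB; apply: cvgD.
  - exact: pairing_continuous (cv s) (ca1 s).
  - exact: pairing_continuous (cb s) (cu1 s).
  - exact: pairing_continuous (cu s) cq.
  - exact: pairing_continuous (cv s) cp.
exists Psi; split=> //.
have [s st|F0 [dF0 AF0]] := action_primitive (H := H) t0 da ca1 cb.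
  exact/differentiable_continuous/dH/Uab.
have A0 : action H t (fun s => q s + 0 *: u s) (fun s => p s + 0 *: v s) =
    pairing (b t) (a t) - (F0 t - F0 0).
  by apply: AF0 => s st; have [-> -> _] := qp s st; rewrite !scale0r !addr0.
(* First the endpoint term [pairing (v t) (u t)], then, over an interval of length t, the quadratic
   part of the pairing and the Taylor remainder of [H]. The radius [r / (M + 1)] keeps the varied
   curve in the tube. *)
pose C := n%:R * M ^+ 2 + (n%:R * M ^+ 2 + L * M ^+ 2) * t.
apply: (@is_derive_quadratic _ _ _ _ _ _ C (r / (M + 1))) => [|h].
  by rewrite divr_gt0// ltr_wpDl.
rewrite ltr_pdivlMr ?ltr_wpDl// => hr.
have hM : `|h| * M < r.
  by apply: le_lt_trans hr; rewrite ler_wpM2l// lerDl.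
have wr s : s \in `[0, t] -> `|(h *: u s, h *: v s)| <= `|h| * M.
  move=> st; have [us vs _] := bounds s st.
  by rewrite prod_normE ge_max !normrZ/= !ler_wpM2l.
have tubh s (st : s \in `[0, t]) :=
  let: And3 _ _ T := tub s st in T _ (le_lt_trans (wr s st) hM).
rewrite [h *: 1]mulr1 add0r.
have dah s : has_derivative (fun s => a s + h *: u s) s (a1 s + h *: u1 s).
  by apply: has_derivativeD; [exact: da|exact: has_derivativeZ (du s)].
have ca1h : continuous (fun s => a1 s + h *: u1 s).
  by move=> s; exact: cvgD (ca1 s) (cvgZl_tmp (cu1 s)).
have cbh : continuous (fun s => b s + h *: v s).
  by move=> s; exact: cvgD (cb s) (cvgZl_tmp (cv s)).
have [s st|F [dF AF]] := action_primitive (H := H) t0 dah ca1h cbh.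
  by have [Us _ _ _] := tubh s st; exact/differentiable_continuous/dH.
rewrite AF => [|s st]; last by have [-> -> _] := qp s st.
rewrite A0.
(* The terms of order [h] cancel in the derivative [G'], leaving those of second order. *)
pose G s := F s - F0 s - h * Psi s.
pose G' s := h ^+ 2 * pairing (v s) (u1 s) -
  (H (a s + h *: u s, b s + h *: v s) - H (a s, b s) -
   (pairing (h *: u s) (gradq H (a s, b s)) +
    pairing (h *: v s) (gradp H (a s, b s)))).
have dG s : s \in `[0, t] -> has_derivative G s (G' s).
  move=> st.
  have := has_derivativeB (has_derivativeB (dF s st) (dF0 s st))
    (has_derivativeMl h (dPsi s st)).
  congr has_derivative.
  rewrite /G' pairing_affine !pairingZl.
  move: (pairing (b s) (a1 s)) (pairing (v s) (a1 s)) (pairing (b s) (u1 s))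
    (pairing (v s) (u1 s)) (pairing (u s) _) (pairing (v s) _)
    (H (a s, b s)) (H _) => x1 x2 x3 x4 x5 x6 x7 x8.
  ring.
have tt : t \in `[0, t] by rewrite in_itv/= ltW/=.
have pn s w1 w2 : s \in `[0, t] -> `|w1 : 'rV[R]_n| <= M -> `|w2| <= M ->
    `|h ^+ 2 * pairing w1 w2| <= h ^+ 2 * (n%:R * M ^+ 2).
  move=> _ w1M w2M; rewrite normrM ger0_norm ?sqr_ge0// ler_wpM2l ?sqr_ge0//.
  apply: (le_trans (norm_pairing_le _ _)).
  by rewrite ler_wpM2l// expr2 ler_pM.
have Gle : `|G t - G 0| <= h ^+ 2 * (n%:R * M ^+ 2 + L * M ^+ 2) * (t - 0).
  apply: (mean_value_bound (ltW t0) dG) => s st.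
  have [us vs u1s] := bounds s st; have [_ _ _ Hs] := tubh s st.
  apply: (le_trans (ler_normB _ _)); rewrite mulrDr.
  apply: (lerD (pn s _ _ st vs u1s)); apply: (le_trans Hs).
  rewrite [leRHS]mulrCA ler_wpM2l ?(ltW L0)// -exprMn.
  rewrite -[leRHS]ger0_norm ?sqr_ge0// normrX normrM.
  by rewrite lerXn2r ?nnegrE ?mulr_ge0// [`|M|]ger0_norm// wr.
have -> : pairing (b t + h *: v t) (a t + h *: u t) - (F t - F 0) -
    (pairing (b t) (a t) - (F0 t - F0 0)) -
    h * (pairing (v t) (a t) + pairing (b t) (u t) - (Psi t - Psi 0)) =
    h ^+ 2 * pairing (v t) (u t) - (G t - G 0).
  rewrite pairing_affine /G; ring.
have [ut vt _] := bounds t tt.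
apply: (le_trans (ler_normB _ _)).
apply: (le_trans (lerD (pn t _ _ tt vt ut) Gle)).
rewrite subr0 /C; lra.
Qed.

(** Varying p alone yields the first equation, varying q alone the second. The variation [G2] must
    vanish at the fixed end, t for p and 0 for q; its derivative [G1] is based at the opposite end,
    so that the boundary products of [double_primitive_eq0] vanish. *)
Lemma hamilton_equations (Q : set 'rV[R]_n) (H : 'rV[R]_n * 'rV[R]_n -> R)
    (t : R) (q0 pt : 'rV[R]_n) (q p a b a1 b1 : R -> 'rV[R]_n) :
  open Q -> Ck 2 (Q `*` setT) H -> 0 < t ->
  (forall s, has_derivative a s (a1 s)) -> continuous a1 ->
  (forall s, has_derivative b s (b1 s)) -> continuous b1 ->
  (forall s, s \in `[0, t] -> [/\ q s = a s, p s = b s & Q (a s)]) ->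
  stationary Q H q0 pt t q p ->
  forall s, s \in `[0, t] ->
    a1 s = gradp H (a s, b s) /\ b1 s = - gradq H (a s, b s).
Proof.
move=> oQ H2 t0 da ca1 db cb1 qp [_ stat].
have ca : continuous a by move=> s; exact: has_derivative_continuous (da s).
have cb : continuous b by move=> s; exact: has_derivative_continuous (db s).
have cab s : {for s, continuous (fun s => (a s, b s))}.
  exact: cvg_pair (ca s) (cb s).
have cDH s w : s \in `[0, t] -> {for (a s, b s), continuous ('D_w H)}.
  move=> st; have [_ DH] := H2; have [dw _] := DH w.
  by apply: differentiable_continuous; apply: dw; have [_ _ ?] := qp s st.
have zero_der s : has_derivative (fun=> 0 : 'rV[R]_n) s 0.
  exact: has_derivative_cst.
have czero : continuous (fun _ : R => 0 : 'rV[R]_n) by exact: cst_continuous.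
have C2_zero : C2_itv t (fun _ : R => 0 : 'rV[R]_n).
  exists (fun=> 0) => //.
  exact: (C2_of_has_derivative zero_der zero_der czero).
pose g := fun s => a1 s - gradp H (a s, b s).
pose k := fun s => b1 s + gradq H (a s, b s).
have cg : continuous (g \o clamp t).
  apply: (comp_clamp_continuous (ltW t0)) => s st.
  have gc := gradp_continuous (fun w => cDH s w st).
  by apply: cvgB; [exact: ca1|exact: (cvg_comp _ _ (cab s) gc)].
have ck : continuous (k \o clamp t).
  apply: (comp_clamp_continuous (ltW t0)) => s st.
  have gc := gradq_continuous (fun w => cDH s w st).
  by apply: cvgD; [exact: cb1|exact: (cvg_comp _ _ (cab s) gc)].
have primitives (f : R -> 'rV[R]_n) (c1 c2 : R) : continuous f ->
    exists G1 G2, [/\ forall s, has_derivative G1 s (f s),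
      forall s, has_derivative G2 s (G1 s), continuous G1, continuous G2 &
      [/\ C2_itv t G2, G1 c1 = 0 & G2 c2 = 0]].
  move=> cf; have [G1 dG1 G10] := row_primitive c1 cf.
  have cG1 : continuous G1.
    by move=> s; exact: has_derivative_continuous (dG1 s).
  have [G2 dG2 G20] := row_primitive c2 cG1.
  have cG2 : continuous G2.
    by move=> s; exact: has_derivative_continuous (dG2 s).
  exists G1, G2; split=> //; split=> //.
  by exists G2 => //; exact: C2_of_has_derivative dG2 dG1 cf.
have g0 s : s \in `[0, t] -> (g \o clamp t) s = 0.
  have [G1 [G2 [dG1 dG2 cG1 cG2 [C2G2 G10 G20]]]] := primitives _ 0 t cg.
  have [Psi [dPsi dA]] :=
    first_variation oQ H2 t0 da ca1 cb zero_der czero cG2 qp.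
  have L0 := has_derivative_unique dA (stat _ _ C2_zero C2G2 erefl G20).
  move: L0; rewrite G20 pairing0l pairing0r addr0 sub0r => /eqP.
  rewrite oppr_eq0 subr_eq0 => /eqP Psit.
  apply: (double_primitive_eq0 t0 cg dG1 dG2 (Phi := Psi)) => //.
  - move=> u ut; rewrite /= clamp_id//.
    have := dPsi u ut; congr has_derivative.
    by rewrite pairing0l pairing0r addr0 add0r pairingBr.
  - by rewrite G10 pairing0l.
  - by rewrite G20 pairing0r.
have k0 s : s \in `[0, t] -> (k \o clamp t) s = 0.
  have [G1 [G2 [dG1 dG2 cG1 cG2 [C2G2 G10 G20]]]] := primitives _ t 0 ck.
  have [Psi [dPsi dA]] :=
    first_variation oQ H2 t0 da ca1 cb dG2 cG1 czero qp.
  have L0 := has_derivative_unique dA (stat _ _ C2G2 C2_zero G20 erefl).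
  move: L0; rewrite pairing0l add0r => L0.
  (* Integration by parts: differentiating [pairing (b s) (G2 s)] cancels the term with [G1] in Psi'
     and leaves [k] paired with [G2]. As [G2 0 = 0], vanishing of the variation says that [Phi] has
     equal values at both ends. *)
  apply: (double_primitive_eq0 t0 ck dG1 dG2
    (Phi := fun s => pairing (b s) (G2 s) - Psi s)) => //.
  - move=> u ut; rewrite /= clamp_id//.
    have := has_derivativeB (has_derivative_pairing (db u) (dG2 u)) (dPsi u ut).
    congr has_derivative.
    rewrite !pairing0l add0r addr0 [RHS]pairingC /k pairingDl.
    rewrite [pairing (gradq _ _) _]pairingC.
    move: (pairing (b1 u) _) (pairing (b u) _) (pairing (G2 u) _) => x1 x2 x3.
    ring.
  - by rewrite G20 pairing0r; move: L0; lra.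
  - by rewrite G20 pairing0r.
  - by rewrite G10 pairing0l.
move=> s st; have := g0 s st; have := k0 s st; rewrite /= clamp_id// /k /g.
by move=> /eqP; rewrite addr_eq0 => /eqP -> /eqP; rewrite subr_eq0 => /eqP ->.
Qed.

End CalculusOfVariations.


(** * Expansion of the action between nearby trajectories *)

Section Trajectories.
Variables (R : realType) (n : nat).
Variables (Q : set 'rV[R]_n) (H : 'rV[R]_n * 'rV[R]_n -> R).
Hypotheses (Q_open : open Q) (H_smooth : Ck 2 (Q `*` [set: 'rV[R]_n]) H).
Local Notation U := (Q `*` [set: 'rV[R]_n]).

Let Hd z : U z -> differentiable H z.
Proof. by have [+ _] := H_smooth; apply. Qed.

(* [F] is a primitive of the integrand of the action. *)
Definition trajectory (t : R) (a b : R -> 'rV[R]_n) (F : R -> R) :=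
  forall s, s \in `[0, t] ->
    [/\ Q (a s), has_derivative a s (gradp H (a s, b s)),
        has_derivative b s (- gradq H (a s, b s)) &
        has_derivative F s (pairing (b s) (gradp H (a s, b s)) - H (a s, b s))].

(** The last clause covers every curve that agrees with the given one on [0, t], because uniqueness
    of stationary curves identifies them there and nowhere else. *)
Lemma stationary_trajectory (t : R) (q0 pt : 'rV[R]_n) (q p : R -> 'rV[R]_n) :
  0 < t -> stationary Q H q0 pt t q p ->
  exists a b F, [/\ continuous a, continuous b, trajectory t a b F,
    (forall s, s \in `[0, t] -> q s = a s /\ p s = b s) &
    forall q' p', (forall s, s \in `[0, t] -> q' s = q s /\ p' s = p s) ->
      action H t q' p' = pairing (b t) (a t) - (F t - F 0)].
Proof.
move=> t0 stat; have [[[a C2a qa] [b C2b pb] Qq _ _] _] := stat.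
have [da ca1] := C2_derivative C2a; have [db cb1] := C2_derivative C2b.
have ca : continuous a by move=> s; exact: has_derivative_continuous (da s).
have cb : continuous b by move=> s; exact: has_derivative_continuous (db s).
have qpab s : s \in `[0, t] -> [/\ q s = a s, p s = b s & Q (a s)].
  by move=> st; rewrite -qa// -pb//; split=> //; exact: Qq.
have ham := hamilton_equations Q_open H_smooth t0 da ca1 db cb1 qpab stat.
have [s st|F [dF AF]] := action_primitive (H := H) t0 da ca1 cb.
  by have [_ _ Qa] := qpab s st; exact/differentiable_continuous/Hd.
exists a, b, F; split=> //.
- move=> s st; have [_ _ Qa] := qpab s st; have [a1E b1E] := ham s st.
  split=> //; [by rewrite -a1E; exact: da|by rewrite -b1E; exact: db|].
  by rewrite -a1E; exact: dF.
- by move=> s st; have [-> -> _] := qpab s st.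
- move=> q' p' qp'; apply: AF => s st.
  by have [-> ->] := qp' s st; have [-> -> _] := qpab s st.
Qed.

Lemma energy_conservation t a b F : trajectory t a b F ->
  forall s, s \in `[0, t] -> H (a s, b s) = H (a t, b t).
Proof.
move=> tr s st.
apply: (@has_derivative0_cst _ (fun s => H (a s, b s)) 0 t) => // u ut.
have [Qa da db _] := tr u ut.
have Uab : U (a u, b u) by [].
have := has_derivative_phase da db (Hd Uab); congr has_derivative.
by rewrite pairingNl [X in _ - X]pairingC subrr.
Qed.

Lemma rescale_itv (t s : R) : 0 <= t -> s \in `[0, 1] -> s * t \in `[0, t].
Proof.
by move=> t0; rewrite !in_itv/= => /andP[s0 s1]; rewrite mulr_ge0//= ler_piMl.
Qed.

(** The left side is the derivative of [Psi] in [action_expansion], with Hamilton's equations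
    inserted and [h], [h'] the values of [H]. On the right stand a Taylor remainder and two products
    of small factors: nothing of first order survives. *)
Lemma expansion_identity (b b' dq gq gp gp' : 'rV[R]_n) (t t' h h' : R) :
  pairing (t *: - gq) dq + pairing b (t' *: gp' - t *: gp) -
    t' * (pairing b' gp' - h') + t * (pairing b gp - h) - (t' - t) * h =
  t' * (h' - h - (pairing dq gq + pairing (b' - b) gp)) +
    (t' - t) * pairing gq dq - t' * pairing (b' - b) (gp' - gp).
Proof. by rewrite !pairingE [pairing dq gq]pairingC; ring. Qed.

Definition rescaled_diff (c' c : R -> 'rV[R]_n) (t' t s : R) :=
  c' (s * t') - c (s * t).

(** The derivative of the squared distance is a sum of four pairings, each at most n L (t + 2) E:
    [t + 1] bounds [t'], and the remaining 1 pays for the difference of the two time scales. *)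
Definition gronwall_rate (t L : R) : R := 4 * n%:R * L * (t + 2).

(** The prefactor bounds the initial value of [E] in units of [eta ^+ 2]: n K^2 for the initial
    momenta and 1 for the summand [eta ^+ 2]. *)
Definition gronwall_factor (t L K : R) : R :=
  (n%:R * K ^+ 2 + 1) * expR (gronwall_rate t L).

Section TwoTrajectories.
Variables (a b : R -> 'rV[R]_n) (F : R -> R) (t L r : R).
Hypotheses (t0 : 0 < t) (L0 : 0 < L) (r0 : 0 < r).
Hypothesis traj : trajectory t a b F.
Hypothesis tub : forall s, s \in `[0, t] -> tube U H L r (a s, b s).

Section Closeness.
Variables (a' b' : R -> 'rV[R]_n) (F' : R -> R) (t' eta K0 : R).
Hypotheses (t'0 : 0 < t') (t'1 : t' <= t + 1) (eta0 : 0 <= eta) (K00 : 0 <= K0).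
Hypothesis tt' : `|t' - t| <= eta.
Hypothesis traj' : trajectory t' a' b' F'.
Hypothesis aa0 : a' 0 = a 0.
Hypothesis bb0 : `|b' 0 - b 0| <= K0 * eta.

Local Notation dQ := (rescaled_diff a' a t' t).
Local Notation dP := (rescaled_diff b' b t' t).
Local Notation rate := (gronwall_rate t L).
Local Notation growth := (gronwall_factor t L K0).
Local Notation dt := (t' - t).

Let norm_hamilton_diff (w : 'rV[R]_n * 'rV[R]_n) (g h : 'rV[R]_n) :
  `|g - h| <= L * `|w| -> `|h| <= L ->
  `|t' *: g - t *: h| <= L * ((t + 1) * `|w| + eta).
Proof.
move=> gh hL.
have -> : t' *: g - t *: h = t' *: (g - h) + (t' - t) *: h.
  by rewrite scalerBr scalerBl addrA subrK.
apply: (le_trans (ler_normD _ _)); rewrite !normrZ (gtr0_norm t'0) mulrDr.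
apply: lerD; last by rewrite mulrC ler_pM.
rewrite mulrCA; apply: ler_pM => //; exact: ltW.
Qed.

Lemma pairing_growth (w : 'rV[R]_n * 'rV[R]_n) (d g : 'rV[R]_n) (E : R) :
  `|d| <= `|w| -> `|w| ^+ 2 <= E -> eta ^+ 2 <= E ->
  `|g| <= L * ((t + 1) * `|w| + eta) ->
  pairing g d + pairing d g <= rate / 2 * E.
Proof.
move=> dw wE etaE gw.
have w0 := normr_ge0 w.
(* Since [E] dominates both squares, it dominates the mixed product. *)
have weta : `|w| * eta <= E.
  have := sqr_ge0 (`|w| - eta); rewrite sqrrB => s0.
  have : `|w| * eta *+ 2 <= E *+ 2 by rewrite [_ *+ 2 in leRHS]mulr2n; lra.
  by rewrite lerMn2r.
have step : pairing d g <= n%:R * (L * ((t + 2) * E)).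
  apply: (le_trans (ler_norm _)); apply: (le_trans (norm_pairing_le _ _)).
  rewrite ler_wpM2l//.
  apply: (@le_trans _ _ (`|w| * (L * ((t + 1) * `|w| + eta)))).
    by rewrite ler_pM.
  rewrite mulrCA ler_wpM2l ?(ltW L0)//.
  have -> : `|w| * ((t + 1) * `|w| + eta) = (t + 1) * `|w| ^+ 2 + `|w| * eta.
    by ring.
  have : (t + 1) * `|w| ^+ 2 <= (t + 1) * E.
    by apply: ler_wpM2l => //; rewrite addr_ge0// ltW.
  lra.
rewrite [pairing g d]pairingC.
have -> : rate / 2 * E =
    n%:R * (L * ((t + 2) * E)) + n%:R * (L * ((t + 2) * E)).
  by rewrite /gronwall_rate; field.
exact: lerD.
Qed.

Lemma trajectories_close : growth * eta ^+ 2 < r ^+ 2 ->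
  forall s, s \in `[0, 1] ->
    `|(dQ s, dP s)| < r /\ `|(dQ s, dP s)| ^+ 2 <= growth * eta ^+ 2.
Proof.
move=> small.
(* The added [eta ^+ 2] absorbs the inhomogeneous terms caused by [t' != t], which makes the
   inequality homogeneous: E' <= rate E. *)
pose E s := pairing (dQ s) (dQ s) + pairing (dP s) (dP s) + eta ^+ 2.
have nE s : `|(dQ s, dP s)| ^+ 2 + eta ^+ 2 <= E s.
  rewrite lerD2r prod_normE/=; have := sqr_norm_le_pairing (dQ s).
  have := sqr_norm_le_pairing (dP s); have := pairing_ge0 (dQ s).
  have := pairing_ge0 (dP s).
  by case: (leP `|dQ s| `|dP s|) => _; lra.
have rate0 : 0 <= rate.
  by rewrite /gronwall_rate mulr_ge0 ?addr_ge0 ?mulr_ge0 ?(ltW t0) ?(ltW L0).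
pose z s := (a (s * t), b (s * t)).
pose z' s := (a' (s * t'), b' (s * t')).
pose dE s := (pairing (t' *: gradp H (z' s) - t *: gradp H (z s)) (dQ s) +
    pairing (dQ s) (t' *: gradp H (z' s) - t *: gradp H (z s))) +
  (pairing (t' *: - gradq H (z' s) - t *: - gradq H (z s)) (dP s) +
    pairing (dP s) (t' *: - gradq H (z' s) - t *: - gradq H (z s))).
have derE s : s \in `[0, 1] -> has_derivative E s (dE s).
  move=> s01.
  have [_ da db _] := traj (rescale_itv (ltW t0) s01).
  have [_ da' db' _] := traj' (rescale_itv (ltW t'0) s01).
  have dQs :=
    has_derivativeB (has_derivative_scale da') (has_derivative_scale da).
  have dPs :=
    has_derivativeB (has_derivative_scale db') (has_derivative_scale db).
  have := has_derivativeD (has_derivativeD (has_derivative_pairing dQs dQs)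
    (has_derivative_pairing dPs dPs)) (has_derivative_cst (eta ^+ 2) s).
  by rewrite addr0.
have dE_le s : s \in `[0, 1] -> E s < r ^+ 2 -> dE s <= rate * E s.
  move=> s01 Er; have st := rescale_itv (ltW t0) s01.
  have [gq gp lip] := tub st.
  have E0 := nE s.
  have w2 : `|(dQ s, dP s)| ^+ 2 <= E s.
    by apply: le_trans E0; rewrite lerDl sqr_ge0.
  have e2 : eta ^+ 2 <= E s by apply: le_trans E0; rewrite lerDr sqr_ge0.
  have wr : `|(dQ s, dP s)| < r.
    by rewrite -(@ltr_pXn2r _ 2) ?nnegrE ?(ltW r0)//; exact: le_lt_trans Er.
  have [_ lq lp _] := lip _ wr.
  have zE : (a (s * t), b (s * t)) + (dQ s, dP s) = z' s.
    by rewrite /z' /rescaled_diff; congr pair => /=; rewrite addrC subrK.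
  rewrite zE in lq lp.
  have lqN : `|- gradq H (z' s) - - gradq H (z s)| <= L * `|(dQ s, dP s)|.
    rewrite -opprD normrN; exact: lq.
  have gqN : `|- gradq H (z s)| <= L by rewrite normrN; exact: gq.
  have gqd := norm_hamilton_diff lqN gqN.
  have gpd := norm_hamilton_diff lp gp.
  have := lerD (pairing_growth (norm_fst_le (dQ s, dP s)) w2 e2 gpd)
    (pairing_growth (norm_snd_le (dQ s, dP s)) w2 e2 gqd).
  by rewrite -mulrDl -splitr.
pose f s := E s * expR (s * - rate).
have derf s : s \in `[0, 1] -> has_derivative f s
    (E s * (- rate * expR (s * - rate)) + expR (s * - rate) * dE s).
  move=> s01; apply: has_derivativeM; first exact: derE.
  exact: (has_derivative_scale (is_derive_expR _)).
have f00 : f 0 <= (n%:R * K0 ^+ 2 + 1) * eta ^+ 2.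
  rewrite /f mul0r expR0 mulr1 /E /rescaled_diff !mul0r aa0 subrr.
  rewrite pairing0l add0r mulrDl mul1r lerD2r.
  apply: (le_trans (ler_norm _)); apply: (le_trans (norm_pairing_le _ _)).
  by rewrite -mulrA ler_wpM2l// -expr2 -exprMn lerXn2r ?nnegrE ?mulr_ge0.
have f0_lt : f 0 < r ^+ 2 * expR (- rate).
  apply: (le_lt_trans f00); rewrite expRN ltr_pdivlMr ?expR_gt0//.
  by rewrite mulrAC.
have f_le : forall s, s \in `[0, 1] -> f s <= f 0.
  (* The level is chosen so that [f s] below it forces [E s < r ^+ 2] for every [s <= 1], that is,
     the point lies in the tube and [dE_le] applies. *)
  apply: (barrier derf) f0_lt => s s01 fs.
  rewrite mulrA [X in X + _]mulrC -mulrDr pmulr_rle0 ?expR_gt0//.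
  rewrite mulrN mulrC addrC subr_le0; apply: dE_le => //.
  have : f s < r ^+ 2 * expR (s * - rate).
    apply: (lt_le_trans fs); rewrite ler_wpM2l ?sqr_ge0// ler_expR mulrN lerN2.
    by rewrite ler_piMl//; move: s01; rewrite in_itv/= => /andP[].
  by rewrite ltr_pM2r ?expR_gt0.
have close s : s \in `[0, 1] -> E s <= growth * eta ^+ 2.
  move=> s01; have := le_trans (f_le s s01) f00.
  rewrite /f mulrN expRN ler_pdivrMr ?expR_gt0// => /le_trans; apply.
  rewrite /gronwall_factor [leRHS]mulrAC ler_wpM2l//.
    by rewrite mulr_ge0 ?sqr_ge0// addr_ge0// mulr_ge0// sqr_ge0.
  by rewrite ler_expR ler_piMl//; move: s01; rewrite in_itv/= => /andP[].
move=> s s01.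
have w2 : `|(dQ s, dP s)| ^+ 2 <= growth * eta ^+ 2.
  apply: le_trans (close s s01); apply: le_trans (nE s).
  by rewrite lerDl sqr_ge0.
split=> //; rewrite -(@ltr_pXn2r _ 2) ?nnegrE ?(ltW r0)//.
exact: le_lt_trans small.
Qed.

(** In the constant, the first summand comes from the product of [dP 1] and [dQ 1], the other three
    from the three terms of [dPsi] in their order. *)
Lemma action_expansion : growth * eta ^+ 2 < r ^+ 2 ->
  `|(pairing (b' t') (a' t') - (F' t' - F' 0)) -
    (pairing (b t) (a t) - (F t - F 0)) -
    (pairing (b' t' - b t) (a t) + dt * H (a t, b t))| <=
  (n%:R * growth + ((t + 1) * (L * growth) + n%:R * (L * (1 + growth)) +
    (t + 1) * (n%:R * (L * growth)))) * eta ^+ 2.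
Proof.
move=> small; have close := trajectories_close small.
have G0 : 0 <= growth.
  by rewrite mulr_ge0 ?expR_ge0// addr_ge0// mulr_ge0// sqr_ge0.
pose w s := (dQ s, dP s).
pose h := H (a t, b t).
pose z s := (a (s * t), b (s * t)).
pose z' s := (a' (s * t'), b' (s * t')).
have zE s : z s + w s = z' s.
  by rewrite /z' /w /rescaled_diff; congr pair => /=; rewrite addrC subrK.
pose Psi s :=
  pairing (b (s * t)) (dQ s) - F' (s * t') + F (s * t) - s * (dt * h).
pose dPsi s := t' * (H (z' s) - H (z s) -
    (pairing (dQ s) (gradq H (z s)) + pairing (dP s) (gradp H (z s)))) +
  dt * pairing (gradq H (z s)) (dQ s) -
  t' * pairing (dP s) (gradp H (z' s) - gradp H (z s)).
have derPsi s : s \in `[0, 1] -> has_derivative Psi s (dPsi s).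
  move=> s01; have st := rescale_itv (ltW t0) s01.
  have [_ da db dF] := traj st.
  have [_ da' db' dF'] := traj' (rescale_itv (ltW t'0) s01).
  have dQs :=
    has_derivativeB (has_derivative_scale da') (has_derivative_scale da).
  have dbQ := has_derivative_pairing (has_derivative_scale db) dQs.
  have dFF := has_derivativeD (has_derivativeB dbQ (has_derivative_scale dF'))
    (has_derivative_scale dF).
  have := has_derivativeB dFF (has_derivative_scalel (dt * h) s).
  congr has_derivative.
  rewrite /h -(energy_conservation traj st).
  exact: expansion_identity.
have eta_w s : s \in `[0, 1] -> eta * `|w s| <= (1 + growth) * eta ^+ 2.
  move=> s01; have [_ w2] := close s s01.
  have := sqr_ge0 (eta - `|w s|); have := sqr_ge0 eta; move: w2.
  rewrite -/(w s).
  move: (`|w s|) growth => x g; rewrite !expr2; nra.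
have dPsi_le s : s \in `[0, 1] -> `|dPsi s| <=
    ((t + 1) * (L * growth) + n%:R * (L * (1 + growth)) +
    (t + 1) * (n%:R * (L * growth))) * eta ^+ 2.
  move=> s01; have [wr w2] := close s s01.
  have [gq _ lip] := tub (rescale_itv (ltW t0) s01).
  have [_ _ lp taylor] := lip _ wr.
  rewrite [X in gradp H X - _](zE s) in lp.
  rewrite [X in H X - _](zE s) in taylor.
  rewrite /dPsi [leRHS]mulrDl; apply: (le_trans (ler_normB _ _)); apply: lerD.
    rewrite [leRHS]mulrDl; apply: (le_trans (ler_normD _ _)); apply: lerD.
      rewrite normrM (gtr0_norm t'0) -[leRHS]mulrA; apply: ler_pM => //.
        exact: ltW.
      apply: (le_trans taylor); rewrite -[leRHS]mulrA ler_wpM2l ?(ltW L0)//.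
    rewrite normrM.
    apply: (le_trans (ler_pM _ _ tt' (norm_pairing_le _ _))) => //.
    rewrite mulrCA -[leRHS]mulrA ler_wpM2l//.
    rewrite mulrCA -[leRHS]mulrA; apply: ler_pM => //.
      by rewrite mulr_ge0.
    apply: le_trans (eta_w s s01); rewrite ler_wpM2l//.
    exact: (norm_fst_le (w s)).
  rewrite normrM (gtr0_norm t'0) -[leRHS]mulrA; apply: ler_pM => //.
    exact: ltW.
  apply: (le_trans (norm_pairing_le _ _)); rewrite -[leRHS]mulrA ler_wpM2l//.
  apply: (le_trans (ler_pM _ _ (norm_snd_le (w s)) lp)) => //.
  by rewrite mulrCA -[leRHS]mulrA ler_wpM2l ?(ltW L0)//; exact: w2.
have in1 : 1 \in `[0 : R, 1] by rewrite in_itv/= ler01 lexx.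
have [_ w2] := close 1 in1.
have := mean_value_bound ler01 derPsi dPsi_le; rewrite subr0 mulr1 => Psi_le.
(* Both curves start at the same position, so [Psi 0] has no boundary pairing. At the end, b'a' - ba
   - (b' - b)a = b'(a' - a), which splits into the pairing inside [Psi 1] and a product of two
   differences. *)
have -> : (pairing (b' t') (a' t') - (F' t' - F' 0)) -
    (pairing (b t) (a t) - (F t - F 0)) -
    (pairing (b' t' - b t) (a t) + dt * H (a t, b t)) =
    pairing (dP 1) (dQ 1) + (Psi 1 - Psi 0).
  rewrite /Psi /rescaled_diff !mul0r !mul1r aa0 subrr pairing0r.
  rewrite !pairingE; rewrite /h.
  move: (pairing (b' t') (a' t')) (pairing (b t) (a t)) (pairing (b' t') (a t))
    (pairing (b t) (a' t')) (F' t') (F' 0) (F t) (F 0) (H _) => *.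
  ring.
rewrite [leRHS]mulrDl; apply: (le_trans (ler_normD _ _)).
apply: lerD; last exact: Psi_le.
apply: (le_trans (norm_pairing_le _ _)); rewrite -mulrA ler_wpM2l//.
apply: le_trans w2; rewrite expr2 mulrC ler_pM//.
  exact: (norm_fst_le (w 1)).
exact: (norm_snd_le (w 1)).
Qed.

End Closeness.
End TwoTrajectories.
End Trajectories.


(** * Derivatives of [S2] and the Hamilton-Jacobi equation *)

Lemma differentiable_near_lipschitz (R : realType) (V W : normedModType R)
    (f : V -> W) (x : V) : differentiable f x ->
  exists2 C : R, 0 <= C & \forall y \near x, `|f y - f x| <= C * `|y - x|.
Proof.
move=> fx; have [k k0 dk] := linear_lipschitz (diff_continuous fx).
exists (k + 1); first by rewrite addr_ge0// ltW.
have := diff_locally fx => /eqaddoP/(_ 1 ltr01) => H.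
rewrite (near_shift 0 x); apply: filterS H => h /=.
rewrite subr0 mul1r => H.
have -> : h + x - x = h by rewrite addrK.
have -> : f (h + x) - f x = 'd f x h + (f (h + x) - (f x + 'd f x h)).
  by rewrite -[LHS](subrK ('d f x h)) [RHS]addrC opprD addrA.
by rewrite (le_trans (ler_normD _ _))// mulrDl mul1r lerD.
Qed.

Theorem proposition1 (R : realType) (n : nat) (Q : set 'rV[R]_n)
  (H : 'rV[R]_n * 'rV[R]_n -> R)
  (Q_open : open Q)
  (H_smooth : Ck 2 (Q `*` [set: 'rV[R]_n]) H)
  (* the arguments ((q0, p), t) considered *)
  (D : set ('rV[R]_n * 'rV[R]_n * R))
  (D_open : open D)
  (D_pos : forall x, D x -> 0 < x.2)
  (* the stationary curve for x = ((q0, p), t), as a function of x *)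
  (qc pc : 'rV[R]_n * 'rV[R]_n * R -> R -> 'rV[R]_n)
  (curve_exists : forall x, D x ->
     stationary Q H x.1.1 x.1.2 x.2 (qc x) (pc x))
  (curve_unique : forall x, D x -> forall q p : R -> 'rV[R]_n,
     stationary Q H x.1.1 x.1.2 x.2 q p ->
     forall s, s \in `[0, x.2] -> q s = qc x s /\ p s = pc x s)
  (* differentiable dependence on x; time is rescaled since the interval [0,t]
     depends on x *)
  (curve_differentiable : forall x, D x -> forall s : R, s \in `[0, 1] ->
     differentiable (fun y => qc y (s * y.2)) x /\
     differentiable (fun y => pc y (s * y.2)) x)
  (q0 p : 'rV[R]_n) (t : R) (Dx : D (q0, p, t)) :
  let dS2_dp := gradient (fun p' => S2 Q H q0 p' t) p in
  [/\ forall i, derivable (fun p' => S2 Q H q0 p' t) p (delta_mx 0 i),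
      Q dS2_dp,
      derivable (fun t' => S2 Q H q0 p t') t 1 &
      derive1 (fun t' => S2 Q H q0 p t') t = H (dS2_dp, p)].
Proof.
have value x : D x -> exists a b F, [/\ continuous a, continuous b,
    trajectory Q H x.2 a b F,
    [/\ a 0 = x.1.1, b x.2 = x.1.2 & b 0 = pc x 0] &
    S2 Q H x.1.1 x.1.2 x.2 =
      pairing (b x.2) (a x.2) - (F x.2 - F 0)].
  move=> Dx'; have x20 := D_pos x Dx'; have st := curve_exists x Dx'.
  have [a [b [F [ca cb tr ab act]]]] :=
    stationary_trajectory Q_open H_smooth x20 st.
  exists a, b, F; split=> //.
    have [[_ _ _ qc0 pct] _] := st.
    have in0 : 0 \in `[0, x.2] by rewrite in_itv/= lexx ltW.
    have in1 : x.2 \in `[0, x.2] by rewrite in_itv/= lexx ltW.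
    have [qE pE] := ab _ in0; have [_ pE'] := ab _ in1.
    by split; [rewrite -qE|rewrite -pE'|rewrite -pE].
  (* [get] returns the action of some stationary curve, which agrees with [qc x], [pc x] on the
     interval; the default value is excluded because a stationary curve exists. *)
  rewrite /S2; case: xgetP => [v -> [q' [p' [st' ->]]]|none].
    by apply: act => s /(curve_unique x Dx' _ _ st').
  exfalso; apply: (none (action H x.2 (qc x) (pc x))).
  by exists (qc x), (pc x).
have t0 : 0 < t := D_pos _ Dx.
have [a [b [F [ca cb tr [a0 bt b0] S2x]]]] := value _ Dx.
rewrite /= in tr a0 bt S2x.
have cab : continuous (fun s => (a s, b s)).
  by move=> s; exact: cvg_pair (ca s) (cb s).
have Uab s : s \in `[0, t] -> (Q `*` [set: 'rV[R]_n]) (a s, b s).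
  by move=> st; have [Qa _ _ _] := tr s st.
have [L [r [L0 r0 tub]]] :=
  compact_tube (open_cylinder Q_open) H_smooth cab Uab.
have in01 : 0 \in `[0 : R, 1] by rewrite in_itv/= lexx ler01.
have [K K0 lipp] :=
  differentiable_near_lipschitz (curve_differentiable _ Dx _ in01).2.
rewrite /= !mul0r in lipp.
have [C [d [d0 expansion]]] : exists C d : R, 0 < d /\
    forall p' t' eta, `|p' - p| <= eta -> `|t' - t| <= eta -> eta < d ->
      `|S2 Q H q0 p' t' - S2 Q H q0 p t -
        (pairing (p' - p) (a t) + (t' - t) * H (a t, p))| <= C * eta ^+ 2.
  have near_x : \forall y \near (q0, p, t), D y /\
      `|pc y (0 * y.2) - pc (q0, p, t) 0| <= K * `|y - (q0, p, t)|.
    by apply: filterI lipp; exact: open_nbhs_nbhs.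
  move: near_x => /nbhs_normP[e /= e0 he].
  pose g := gronwall_factor n t L K.
  have g0 : 0 <= g.
    by rewrite mulr_ge0 ?expR_ge0// addr_ge0// mulr_ge0// sqr_ge0.
  exists (n%:R * g + ((t + 1) * (L * g) + n%:R * (L * (1 + g)) +
    (t + 1) * (n%:R * (L * g)))).
  (* [e] keeps the new parameters in [D] and within the Lipschitz estimate, 1 gives [t' <= t + 1]
     and [eta ^+ 2 <= eta], and the last bound then yields [g * eta ^+ 2 < r ^+ 2]. *)
  exists (Num.min e (Num.min 1 (r ^+ 2 / (g + 1)))).
  split; first by rewrite !lt_min e0 ltr01 divr_gt0 ?exprn_gt0// ltr_wpDl.
  move=> p' t' eta pp' tt'; rewrite !lt_min => /and3P[eta_e eta1].
  rewrite ltr_pdivlMr ?ltr_wpDl// => eta_r.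
  have eta0 : 0 <= eta by exact: le_trans tt'.
  pose y := (q0, p', t').
  have yx : `|y - (q0, p, t)| <= eta.
    by rewrite !prod_normE/= subrr normr0 !ge_max eta0 pp'.
  have [Dy py] : D y /\
      `|pc y (0 * y.2) - pc (q0, p, t) 0| <= K * `|y - (q0, p, t)|.
    by apply: he; rewrite /= distrC; exact: le_lt_trans eta_e.
  have t'0 : 0 < t' := D_pos _ Dy.
  have [a' [b' [F' [ca' cb' tr' [a0' bt' b0'] S2y]]]] := value _ Dy.
  rewrite /= in tr' a0' bt' S2y.
  have t't : t' <= t + 1 by have := ler_norm (t' - t); lra.
  have aa' : a' 0 = a 0 by rewrite a0.
  have bb' : `|b' 0 - b 0| <= K * eta.
    move: py; rewrite b0' b0 mul0r => /le_trans; apply.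
    by rewrite ler_wpM2l.
  have small : g * eta ^+ 2 < r ^+ 2.
    apply: le_lt_trans eta_r; rewrite expr2 mulrCA ler_wpM2l//.
    have : g * eta <= g by rewrite ler_piMr// ltW.
    by move=> /le_trans; apply; rewrite lerDl.
  have := action_expansion H_smooth t0 L0 r0 tr tub t'0 t't eta0 K0 tt' tr'
    aa' bb' small.
  by rewrite S2x S2y bt' bt.
have derp i : is_derive p (delta_mx 0 i) (fun p' => S2 Q H q0 p' t) (a t 0 i).
  apply: (@is_derive_quadratic _ _ _ _ _ _ C d d0) => h hd.
  have := expansion (p + h *: delta_mx 0 i) t `|h|.
  rewrite addrAC subrr add0r pairingZl pairing_delta subrr normr0 mul0r addr0.
  rewrite real_normK ?num_real//; apply=> //.
  rewrite normrZ ler_piMr//; apply: rV_norm_le => // j.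
  by rewrite mxE; case: (_ && _); rewrite ?normr1 ?normr0.
have dert : is_derive t (1 : R) (fun t' => S2 Q H q0 p t') (H (a t, p)).
  apply: (@is_derive_quadratic _ _ _ _ _ _ C d d0) => h hd.
  rewrite [h *: 1]mulr1.
  have := expansion p (t + h) `|h|.
  have -> : t + h - t = h by rewrite addrAC subrr add0r.
  rewrite subrr pairing0l add0r normr0.
  by rewrite real_normK ?num_real//; apply.
have gradE : gradient (fun p' => S2 Q H q0 p' t) p = a t.
  by apply/rowP => i; rewrite mxE; have [] := derp i.
have in1 : t \in `[0, t] by rewrite in_itv/= lexx ltW.
rewrite /= gradE; split.
- by move=> i; have [] := derp i.
- by have [] := tr _ in1.
- by have [] := dert.
- by rewrite derive1E; have [] := dert.
Qed.
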